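(* Let $\mathrm{DM}$ be a decomposition method, let $\mathbb{A}$ be a connected left-hand structure, and let $O\subseteq A$ be a set of variables. Then, for every right-hand structure $\mathbb{B}$, the algorithm $\mathtt{ComputeCertifiedSolutions}_{\mathrm{DM}}$ run on $(\mathbb{A},\mathbb{B},O)$ computes, with polynomial delay (WPD), a subset of the solutions in $\mathbb{A}^{\mathbb{B}}[O]$, with a certificate for each of them. Moreover, - if $\mathtt{ComputeCertifiedSolutions}_{\mathrm{DM}}$ outputs ''DM failure'', then $(\mathcal{H}_{\mathbb{A}},\mathcal{H}_{\ell\text{-DM}(\mathbb{A})})$ does not have a tree projection; - otherwise, $\mathtt{ComputeCertifiedSolutions}_{\mathrm{DM}}$ computes WPD $\mathbb{A}^{\mathbb{B}}[O]$.
   Context: **Structures and homomorphisms.** All structures are finite. A relational structure $\mathbb{A}$ over a finite vocabulary $\tau$ has a universe $A$ (whose elements are called variables when $\mathbb{A}$ is the left-hand structure) and a relation $R^{\mathbb{A}}\subseteq A^r$ for each $r$-ary $R\in\tau$. A CSP instance is a pair $(\mathbb{A},\mathbb{B})$ of structures over the same vocabulary ($\mathbb{A}$ left-hand, $\mathbb{B}$ right-hand). $\mathbb{A}^{\mathbb{B}}$ is the set of homomorphisms from $\mathbb{A}$ to $\mathbb{B}$, and $\mathbb{A}^{\mathbb{B}}[X]$ the set of their restrictions to $X\subseteq A$; $\mathbb{A}^{\mathbb{B}}[\emptyset]$ is a one-element set if a homomorphism exists and is empty otherwise. An ECSP instance is a triple $(\mathbb{A},\mathbb{B},O)$ with $O\subseteq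 A$; the task is to compute $\mathbb{A}^{\mathbb{B}}[O]$, whose elements are the solutions of the instance. A certified solution is a pair $(h,c)$ such that, using the certificate $c$, one may check in time polynomial in the size of $(\mathbb{A},\mathbb{B},O)$ whether $h\in\mathbb{A}^{\mathbb{B}}[O]$; e.g., values for the remaining variables $A\setminus O$ extending $h$ to a full homomorphism form such a certificate. **Polynomial delay (WPD).** An algorithm computes solutions WPD if there is a polynomial $p$ such that, for every instance of size $n$, it discovers within time $O(p(n))$ if there are no solutions to output; otherwise it outputs the solutions in such a way that each new solution is computed within $O(p(n))$ time from the previous one (the first within $O(p(n))$ time from the start). **Hypergraphs and tree projections.** $\mathcal{H}_{\mathbb{A}}$ is the hypergraph with node set $A$ and, for each tuple in each relation of $\mathbb{A}$, a hyperedge consisting of the variables in the tuple. $\mathbb{A}$ is connected if $\mathcal{H}_{\mathbb{A}}$ is. A hypergraph is acyclic if it has a join tree: a tree whose vertices are its hyperedges such that, whenever a node $X$ occurs in two hyperedges, $X$ occurs in every vertex on the path linking them. $\mathcal{H}_1\le\mathcal{H}_2$ means every hyperedge of $\mathcal{H}_1$ is contained in some hyperedge of $\mathcal{H}_2$. A tree projection of $(\mathcal{H}_1,\mathcal{H}_2)$ is an acyclic hypergraph $\mathcal{H}_a$ with $\mathcal{H}_1\le\mathcal{H}_a\le\mathcal{H}_2$. **Views and decomposition methods.** A view structure for $\mathbb{A}$ is a structure $\mathbb{A}_{\mathcal V}$ with universe $A$ over a vocabulary $\tau_{\mathcal V}$ disjoint from $\tau$, in which every relation contains a single tuple (whose set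 of variables is denoted $\mathrm{var}(R^{\mathbb{A}_{\mathcal V}})$), and such that for every $R\in\tau$ and $t\in R^{\mathbb{A}}$ there is a symbol $R_t\in\tau_{\mathcal V}$, called a base view, with $R_t^{\mathbb{A}_{\mathcal V}}=\{t\}$. A structure $\mathbb{B}_{\mathcal V}$ over $\tau_{\mathcal V}$ is legal w.r.t. $\mathbb{A}_{\mathcal V}$ and $(\mathbb{A},\mathbb{B})$ if for every $R\in\tau_{\mathcal V}$, $R^{\mathbb{B}_{\mathcal V}}\supseteq\mathbb{A}^{\mathbb{B}}[\mathrm{var}(R^{\mathbb{A}_{\mathcal V}})]$ (tuples identified with assignments to the variables of the view), and for every base view $R_t$ (with $t\in R^{\mathbb A}$), $R_t^{\mathbb{B}_{\mathcal V}}\subseteq R^{\mathbb{B}}$. A decomposition method $\mathrm{DM}$ is a pair of polynomial-time computable functions $\ell\text{-DM}$, $r\text{-DM}$ such that for every CSP instance $(\mathbb{A},\mathbb{B})$, $\ell\text{-DM}(\mathbb{A})$ is a view structure for $\mathbb{A}$ and $r\text{-DM}(\mathbb{A},\mathbb{B})$ is legal w.r.t. $\ell\text{-DM}(\mathbb{A})$ and $(\mathbb{A},\mathbb{B})$. **GAC.** $\mathrm{GAC}(\mathbb{A}_{\mathcal V},\mathbb{B}_{\mathcal V})$ is the right-hand structure obtained from $\mathbb{B}_{\mathcal V}$ by deleting tuples until every two views having a nonempty set $\bar X$ of common variables have the same projection on $\bar X$ (the largest such sub-structure). **Domain restriction.** A variable $X$ is domain restricted in $\mathbb{A}$ if the vocabulary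 contains a distinguished unary symbol $\mathrm{dom}(X)$ with $\mathrm{dom}(X)^{\mathbb{A}}=\{\langle X\rangle\}$. A domain-restricted version of $(\mathbb{A},\mathbb{B},A)$ is obtained by adding, for every variable $X\in A$ that is not domain restricted, a fresh unary constraint $\mathrm{dom}(X)$ on $X$ whose values in the right-hand structure are those taken from (the column of $X$ in) any constraint relation where $X$ occurs; it has the same solutions. The base view of the constraint $\mathrm{dom}(X)$ is also denoted $\mathrm{dom}(X)$. **Algorithm $\mathtt{ComputeCertifiedSolutions}_{\mathrm{DM}}$.** Input: an ECSP instance $(\mathbb{A},\mathbb{B},O)$, $O=\{X_1,\dots,X_m\}$. Let $A=\{X_1,\dots,X_m,X_{m+1},\dots,X_n\}$ be the variables of $\mathbb{A}$; replace $(\mathbb{A},\mathbb{B},A)$ by any of its domain-restricted versions; let $\mathbb{A}_{\mathcal V}:=\ell\text{-DM}(\mathbb{A})$, $\mathbb{B}_{\mathcal V}:=r\text{-DM}(\mathbb{A},\mathbb{B})$; call $\mathtt{CPropagate}(1,(\mathbb{A}_{\mathcal V},\mathbb{B}_{\mathcal V}),m,\langle\rangle)$. The procedure $\mathtt{CPropagate}(i,(\mathbb{A}_{\mathcal V},\mathbb{B}_{\mathcal V}),m,\langle a_1,\dots,a_{i-1}\rangle)$ is: let $\mathbb{B}'_{\mathcal V}:=\mathrm{GAC}(\mathbb{A}_{\mathcal V},\mathbb{B}_{\mathcal V})$; if $i>1$ and $\mathbb{B}'_{\mathcal V}$ is empty, output ''DM failure'' and halt the whole computation; let $\mathit{activeValues}:=\mathrm{dom}(X_i)^{\mathbb{B}'_{\mathcal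 V}}$; for each $\langle a_i\rangle\in\mathit{activeValues}$: if $i=n$, output the certified solution $(\langle a_1,\dots,a_m\rangle,\langle a_{m+1},\dots,a_n\rangle)$; otherwise set $\mathrm{dom}(X_i)^{\mathbb{B}'_{\mathcal V}}$ to $\{\langle a_i\rangle\}$ and call $\mathtt{CPropagate}(i+1,(\mathbb{A}_{\mathcal V},\mathbb{B}'_{\mathcal V}),m,\langle a_1,\dots,a_i\rangle)$; then, in both cases, if $i>m$, break out of the for-loop (so only one value is tried for each non-output variable).
   Formalization: In the failure clause, ℓ-DM is applied to the domain-restricted version of 𝔸 that the algorithm actually uses (with the original 𝔸 the claim can fail); relations and views have positive arity, and connected structures have a nonempty universe. *)

(* Defs.v *)
From HB Require Import structures.
From mathcomp Require Import all_boot all_order all_algebra.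

Set Implicit Arguments.
Unset Strict Implicit.
Unset Printing Implicit Defensive.

(** * Relational structures *)

(* [Dom x] is the reserved name of the distinguished unary symbol dom(x). *)
Inductive symbol := Sym of nat | Dom of nat.

Definition symbol_code (R : symbol) : nat + nat :=
  match R with Sym k => inl k | Dom x => inr x end.
Definition symbol_decode (c : nat + nat) : symbol :=
  match c with inl k => Sym k | inr x => Dom x end.
Lemma symbol_codeK : cancel symbol_code symbol_decode. Proof. by case. Qed.
HB.instance Definition _ := Equality.copy symbol (can_type symbol_codeK).

(* Symbols of view vocabularies; [Base R t] is the base view R_t.  Being of
   another type, they are disjoint from the symbols of instances. *)
Inductive view_symbol := Base of symbol & seq nat | Aux of nat.

Definition view_symbol_code (V : view_symbol) : symbol * seq nat + nat :=
  match V with Base R t => inl (R, t) | Aux k => inr k end.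
Definition view_symbol_decode (c : symbol * seq nat + nat) : view_symbol :=
  match c with inl (R, t) => Base R t | inr k => Aux k end.
Lemma view_symbol_codeK : cancel view_symbol_code view_symbol_decode.
Proof. by case. Qed.
HB.instance Definition _ :=
  Equality.copy view_symbol (can_type view_symbol_codeK).

(* The universe is {0, ..., univ - 1}; [rels] lists the entries
   ((symbol, arity), tuples).  Lists of tuples stand for sets: order and
   repetitions are irrelevant. *)
Record structure (S : Type) := Structure {
  univ : nat;
  rels : seq ((S * nat) * seq (seq nat)) }.

Section StructureOps.
Variable S : eqType.
Implicit Type A : structure S.

Definition vocab A : seq (S * nat) := [seq r.1 | r <- rels A].
Definition symbols A : seq S := [seq v.1 | v <- vocab A].
Definition interp A (R : S) : seq (seq nat) :=
  flatten [seq r.2 | r <- rels A & r.1.1 == R].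
Definition tuples A : seq (seq nat) := flatten [seq r.2 | r <- rels A].

Definition wf A : bool :=
  uniq (symbols A) &&
  all (fun r => (0 < r.1.2) &&
         all (fun t => (size t == r.1.2) && all (fun x => x < univ A) t) r.2)
      (rels A).

Definition is_empty A : bool := all (fun r => nilp r.2) (rels A).

Definition set_rel A (R : S) (ts : seq (seq nat)) : structure S :=
  Structure (univ A) [seq if r.1.1 == R then (r.1, ts) else r | r <- rels A].

Definition hypergraph_of (n : nat) A : {set {set 'I_n}} :=
  [set:: [seq [set i : 'I_n | (i : nat) \in t] | t <- tuples A]].

End StructureOps.

Definition domain_restricted (A : structure symbol) (x : nat) : bool :=
  (Dom x \in symbols A) && (undup (interp A (Dom x)) == [:: [:: x]]).

(* In a left-hand structure the reserved symbols have their intended meaning,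
   so that [Dom x] is fresh whenever x is not domain restricted. *)
Definition wf_left (A : structure symbol) : Prop :=
  wf A /\ forall x, Dom x \in symbols A -> domain_restricted A x.

Definition csp (A B : structure symbol) : Prop :=
  [/\ wf_left A, wf B & perm_eq (vocab A) (vocab B)].

Definition hom (A B : structure symbol) (h : nat -> nat) : Prop :=
  (forall x, x < univ A -> h x < univ B) /\
  (forall R t, t \in interp A R -> map h t \in interp B R).

(* v, read along the list of variables X, belongs to A^B[X] *)
Definition hom_restr (A B : structure symbol) (X v : seq nat) : Prop :=
  exists2 h, hom A B h & v = map h X.

(* The output variables are given as an enumeration X_1, ..., X_m of O. *)
Record instance := Instance {
  lhs : structure symbol;
  rhs : structure symbol;
  outv : seq nat }.

Definition ecsp (I : instance) : Prop :=
  [/\ csp (lhs I) (rhs I), uniq (outv I)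
    & all (fun x => x < univ (lhs I)) (outv I)].

(** * Hypergraphs on the node set 'I_n, given by their sets of hyperedges *)

Section Hypergraphs.
Variable n : nat.
Implicit Type H : {set {set 'I_n}}.

Definition hconnected H : bool :=
  (0 < n) &&
  [forall x, forall y,
    connect (fun u v => [exists e in H, (u \in e) && (v \in e)]) x y].

(* u :: p is a simple path from u to v of the graph with vertices H and edges
   E *)
Definition simple_path H (E : rel {set 'I_n}) (u v : {set 'I_n})
    (p : seq {set 'I_n}) : bool :=
  [&& path E u p, last u p == v, uniq (u :: p) & all (mem H) (u :: p)].

Definition is_tree H (E : rel {set 'I_n}) : Prop :=
  symmetric E /\
  forall u v, u \in H -> v \in H -> exists! p, simple_path H E u v p.

Definition join_tree H (E : rel {set 'I_n}) : Prop :=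
  is_tree H E /\
  forall u v p x, simple_path H E u v p -> x \in u -> x \in v ->
    all (fun w : {set 'I_n} => x \in w) p.

Definition acyclic H : Prop := exists E, join_tree H E.

Definition hle H1 H2 : Prop :=
  forall e, e \in H1 -> exists2 f, f \in H2 & e \subset f.

Definition tree_projection H1 H2 Ha : Prop :=
  [/\ acyclic Ha, hle H1 Ha & hle Ha H2].

End Hypergraphs.

Definition connected (A : structure symbol) : bool :=
  hconnected (hypergraph_of (univ A) A).

(** * A machine model with output

   Data are binary trees.  A program maps trees to trees and may emit trees on
   the way.  Every elementary operation is charged the size of the trees it
   reads or copies (no sharing), so that running times agree with those of
   multitape Turing machines up to a polynomial. *)

Inductive tree := Leaf | Node of tree & tree.

Fixpoint tree_size (x : tree) : nat :=
  match x with Leaf => 1 | Node l r => (tree_size l + tree_size r).+1 end.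

Inductive prog :=
| PLeaf                     (* constant Leaf *)
| PId
| PFst
| PSnd
| PEq                       (* equality test on the components of a pair *)
| POut                      (* emit the argument *)
| PPair of prog & prog
| PComp of prog & prog      (* first program first *)
| PIf of prog & prog & prog
| PWhile of prog & prog.

(* A log is the chronological record of a run: [None] is one time unit and
   [Some x] the emission of x. *)
Definition log := seq (option tree).

Definition tick (k : nat) : log := nseq k None.

(* A test succeeds when its result is not Leaf. *)
Inductive eval : prog -> tree -> tree -> log -> Prop :=
| ev_leaf x : eval PLeaf x Leaf (tick (tree_size x))
| ev_id x : eval PId x x (tick (tree_size x))
| ev_fst_leaf : eval PFst Leaf Leaf (tick 1)
| ev_fst l r : eval PFst (Node l r) l (tick (tree_size (Node l r)))
| ev_snd_leaf : eval PSnd Leaf Leaf (tick 1)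
| ev_snd l r : eval PSnd (Node l r) r (tick (tree_size (Node l r)))
| ev_eq_leaf : eval PEq Leaf Leaf (tick 1)
| ev_eq_true x :
    eval PEq (Node x x) (Node Leaf Leaf) (tick (tree_size (Node x x)))
| ev_eq_false x y : x <> y ->
    eval PEq (Node x y) Leaf (tick (tree_size (Node x y)))
| ev_out x : eval POut x x (rcons (tick (tree_size x)) (Some x))
| ev_pair P Q x y z l1 l2 :
    eval P x y l1 -> eval Q x z l2 ->
    eval (PPair P Q) x (Node y z)
         (tick (tree_size x) ++ l1 ++ l2 ++ tick (tree_size (Node y z)))
| ev_comp P Q x y z l1 l2 :
    eval P x y l1 -> eval Q y z l2 -> eval (PComp P Q) x z (l1 ++ l2)
| ev_if_true C P Q x u v y l1 l2 :
    eval C x (Node u v) l1 -> eval P x y l2 ->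
    eval (PIf C P Q) x y (tick (tree_size x) ++ l1 ++ l2)
| ev_if_false C P Q x y l1 l2 :
    eval C x Leaf l1 -> eval Q x y l2 ->
    eval (PIf C P Q) x y (tick (tree_size x) ++ l1 ++ l2)
| ev_while_stop C P x l :
    eval C x Leaf l -> eval (PWhile C P) x x (tick (tree_size x) ++ l)
| ev_while_step C P x u v y z l1 l2 l3 :
    eval C x (Node u v) l1 -> eval P x y l2 -> eval (PWhile C P) y z l3 ->
    eval (PWhile C P) x z (tick (tree_size x) ++ l1 ++ l2 ++ l3).

Definition polytime (T U : Type) (D : T -> Prop)
    (encT : T -> tree) (encU : U -> tree) (f : T -> U) : Prop :=
  exists (P : prog) (p : {poly nat}), forall x, D x ->
    exists2 k, eval P (encT x) (encU (f x)) (tick k)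
             & k <= (p.[tree_size (encT x)])%R.

(* On input x, program P halts having emitted the sequence outs; at most d time
   units elapse before the first emission, between two consecutive ones, and
   between the last one and the end of the run. *)
Definition runs_with_delay (P : prog) (x : tree) (outs : seq tree) (d : nat) :
    Prop :=
  exists y l, [/\ eval P x y l, pmap id l = outs
    & forall l1 k l2, l = l1 ++ tick k ++ l2 -> k <= d].

(** ** Encodings (numbers in unary: elements range over listed universes) *)

Fixpoint enc_nat (k : nat) : tree :=
  if k is k'.+1 then Node Leaf (enc_nat k') else Leaf.

Definition enc_seq (T : Type) (enc : T -> tree) (s : seq T) : tree :=
  foldr (fun x r => Node (enc x) r) Leaf s.

Definition enc_pair (T U : Type) (encT : T -> tree) (encU : U -> tree)
    (x : T * U) : tree := Node (encT x.1) (encU x.2).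

Definition enc_symbol (R : symbol) : tree :=
  match R with
  | Sym k => Node Leaf (enc_nat k)
  | Dom x => Node (Node Leaf Leaf) (enc_nat x)
  end.

Definition enc_view_symbol (V : view_symbol) : tree :=
  match V with
  | Base R t => Node Leaf (Node (enc_symbol R) (enc_seq enc_nat t))
  | Aux k => Node (Node Leaf Leaf) (enc_nat k)
  end.

Definition enc_structure (S : Type) (encS : S -> tree) (A : structure S) :
    tree :=
  Node (enc_nat (univ A))
       (enc_seq (enc_pair (enc_pair encS enc_nat) (enc_seq (enc_seq enc_nat)))
                (rels A)).

Definition enc_csp : structure symbol * structure symbol -> tree :=
  enc_pair (enc_structure enc_symbol) (enc_structure enc_symbol).

Definition enc_instance (I : instance) : tree :=
  Node (enc_csp (lhs I, rhs I)) (enc_seq enc_nat (outv I)).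

(** * Views and decomposition methods *)

Definition view_structure (A : structure symbol) (AV : structure view_symbol) :
    Prop :=
  [/\ wf AV,
      univ AV = univ A,
      forall V, V \in symbols AV -> exists t, interp AV V =i [:: t]
    & forall R t, t \in interp A R -> interp AV (Base R t) =i [:: t]].

Definition legal (A B : structure symbol) (AV BV : structure view_symbol) :
    Prop :=
  [/\ wf BV,
      perm_eq (vocab BV) (vocab AV),
      forall V t v, t \in interp AV V -> hom_restr A B t v -> v \in interp BV V
    & forall R t, t \in interp A R ->
        {subset interp BV (Base R t) <= interp B R}].

Record dm := DM {
  l_dm : structure symbol -> structure view_symbol;
  r_dm : structure symbol -> structure symbol -> structure view_symbol }.

Definition decomposition_method (M : dm) : Prop :=
  [/\ polytime wf_left (enc_structure enc_symbol)
        (enc_structure enc_view_symbol) (l_dm M),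
      polytime (fun AB => csp AB.1 AB.2) enc_csp
        (enc_structure enc_view_symbol) (fun AB => r_dm M AB.1 AB.2)
    & forall A B, csp A B ->
        view_structure A (l_dm M A) /\ legal A B (l_dm M A) (r_dm M A B)].

(** * Generalized arc consistency *)

(* A tuple s of a view with variables t is identified with the set of its
   pairs (variable, value), so a tuple giving two values to one variable
   agrees with no value of that variable. *)
Definition proj (X t s : seq nat) : seq (nat * nat) :=
  [seq p <- zip t s | p.1 \in X].

Definition consistent (AV BV : structure view_symbol) : Prop :=
  forall V W t u, t \in interp AV V -> u \in interp AV W ->
    let X := [seq x <- t | x \in u] in
    X != [::] ->
    forall s, s \in interp BV V ->
      exists2 s', s' \in interp BV W & proj X t s =i proj X u s'.

Definition substructure (C B : structure view_symbol) : Prop :=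
  [/\ univ C = univ B, vocab C = vocab B
    & forall V, {subset interp C V <= interp B V}].

Definition gac (AV BV BV' : structure view_symbol) : Prop :=
  [/\ substructure BV' BV, consistent AV BV'
    & forall C, substructure C BV -> consistent AV C -> substructure C BV'].

(** * The algorithm *)

(* [dom_choice A B D]: D lists, for every variable x that is not domain
   restricted, admissible values for the fresh constraint dom(x), namely a
   column of x in some constraint relation.  A variable without constraints
   (possible in a connected structure only if it is the sole variable) ranges
   over the universe. *)
Definition dom_choice (A B : structure symbol) (D : seq (seq nat)) : Prop :=
  forall x, x < univ A -> ~~ domain_restricted A x ->
    (exists R t j, [/\ t \in interp A R, j < size t, nth 0 t j = x
       & nth [::] D x =i [seq nth 0 s j | s <- interp B R]]) \/
    ((forall R t, t \in interp A R -> x \notin t) /\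
     nth [::] D x =i iota 0 (univ B)).

Definition fresh_doms (A : structure symbol) (vals : nat -> seq (seq nat)) :=
  [seq ((Dom x, 1), vals x) | x <- iota 0 (univ A) & ~~ domain_restricted A x].

Definition restrict_left (A : structure symbol) : structure symbol :=
  Structure (univ A) (rels A ++ fresh_doms A (fun x => [:: [:: x]])).

Definition restrict_right (A B : structure symbol) (D : seq (seq nat)) :
    structure symbol :=
  Structure (univ B)
    (rels B ++ fresh_doms A (fun x => [seq [:: a] | a <- nth [::] D x])).

Definition dom_view (x : nat) : view_symbol := Base (Dom x) [:: x].

(* [Some (h, c)]: the solution h with certificate c; [None]: "DM failure".
   The certificate <a_(m+1), ..., a_n> is recorded as the list of the pairs
   (X_j, a_j), so as to be readable without knowing the enumeration of the
   variables that was used. *)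
Definition output := option (seq nat * seq (nat * nat)).

Definition enc_certificate : seq (nat * nat) -> tree :=
  enc_seq (enc_pair enc_nat enc_nat).

Definition enc_output (o : output) : tree :=
  if o is Some hc then enc_pair (enc_seq enc_nat) enc_certificate hc else Leaf.

Definition solutions (out : seq output) : seq (seq nat) :=
  [seq hc.1 | hc <- pmap id out].

(* [cpropagate AV m ys xs BV a out b]: with ys = X_(m+1), ..., X_n,
   xs = X_i, ..., X_n and a = <a_1, ..., a_(i-1)>, so that i - 1 = size a, the
   call CPropagate(i, (AV, BV), m, a) may output the sequence out; b tells
   whether it halts the whole computation.  Any order on active values is allowed.
   [cploop] is the for-loop on the remaining active values, and [cpbody] the
   treatment of one of them before the final break test i > m. *)
Inductive cpropagate (AV : structure view_symbol) (m : nat) (ys : seq nat) :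
  seq nat -> structure view_symbol -> seq nat -> seq output -> bool -> Prop :=
| cp_failure x xs BV BV' a :
    gac AV BV BV' -> 0 < size a -> is_empty BV' ->
    cpropagate AV m ys (x :: xs) BV a [:: None] true
| cp_search x xs BV BV' a vs out b :
    gac AV BV BV' -> ~~ ((0 < size a) && is_empty BV') ->
    uniq vs -> [seq [:: v] | v <- vs] =i interp BV' (dom_view x) ->
    cploop AV m ys x xs BV' a vs out b ->
    cpropagate AV m ys (x :: xs) BV a out b
with cploop (AV : structure view_symbol) (m : nat) (ys : seq nat) :
  nat -> seq nat -> structure view_symbol -> seq nat -> seq nat ->
  seq output -> bool -> Prop :=
| cpl_done x xs BV' a : cploop AV m ys x xs BV' a [::] [::] false
| cpl_halt x xs BV' a v vs out :
    cpbody AV m ys x xs BV' a v out true ->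
    cploop AV m ys x xs BV' a (v :: vs) out true
| cpl_break x xs BV' a v vs out :
    cpbody AV m ys x xs BV' a v out false -> m < (size a).+1 ->
    cploop AV m ys x xs BV' a (v :: vs) out false
| cpl_next x xs BV' a v vs out1 out2 b :
    cpbody AV m ys x xs BV' a v out1 false -> (size a).+1 <= m ->
    cploop AV m ys x xs BV' a vs out2 b ->
    cploop AV m ys x xs BV' a (v :: vs) (out1 ++ out2) b
with cpbody (AV : structure view_symbol) (m : nat) (ys : seq nat) :
  nat -> seq nat -> structure view_symbol -> seq nat -> nat ->
  seq output -> bool -> Prop :=
| cpb_output x BV' a v :
    cpbody AV m ys x [::] BV' a v
      [:: Some (take m (rcons a v), zip ys (drop m (rcons a v)))] false
| cpb_call x y xs BV' a v out b :
    cpropagate AV m ys (y :: xs) (set_rel BV' (dom_view x) [:: [:: v]])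
      (rcons a v) out b ->
    cpbody AV m ys x (y :: xs) BV' a v out b.

(* The choices left open before the first call to CPropagate: an enumeration
   X_(m+1), ..., X_n of the other variables, and a domain-restricted
   version. *)
Definition choice := (seq nat * seq (seq nat))%type.

Definition valid_choice (I : instance) (c : choice) : Prop :=
  perm_eq (outv I ++ c.1) (iota 0 (univ (lhs I))) /\
  dom_choice (lhs I) (rhs I) c.2.

Definition enc_choice : choice -> tree :=
  enc_pair (enc_seq enc_nat) (enc_seq (enc_seq enc_nat)).

(* A polynomial-time policy making these choices. *)
Definition choice_policy (rho : instance -> choice) : Prop :=
  (forall I, ecsp I -> valid_choice I (rho I)) /\
  polytime ecsp enc_instance enc_choice rho.

(* ComputeCertifiedSolutions may output the sequence out on the instance I,
   under the choices c. *)
Definition execution (M : dm) (I : instance) (c : choice) (out : seq output) :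
    Prop :=
  let A' := restrict_left (lhs I) in
  let B' := restrict_right (lhs I) (rhs I) c.2 in
  exists b, cpropagate (l_dm M A') (size (outv I)) c.1 (outv I ++ c.1)
    (r_dm M A' B') [::] out b.

(** * Certificates *)

Definition enc_certified (I : instance) (h : seq nat)
    (c : seq (nat * nat)) : tree :=
  Node (enc_instance I) (Node (enc_seq enc_nat h) (enc_certificate c)).

(* [V] only accepts (I, h, c) if h is a solution of I. *)
Definition sound_checker (V : prog) : Prop :=
  forall I h c u v l, ecsp I ->
    eval V (enc_certified I h c) (Node u v) l ->
    hom_restr (lhs I) (rhs I) (outv I) h.

Definition accepts_within (V : prog) (I : instance) (h : seq nat)
    (c : seq (nat * nat)) (d : nat) : Prop :=
  exists u v k, eval V (enc_certified I h c) (Node u v) (tick k) /\ k <= d.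

(* Main.v *)
(** The search visits, depth first, the partial assignments <a_1, ..., a_i> that survive
propagation. Propagation may be recomputed from the initial views with all the domain
restrictions imposed at once, so that the state of the machine is just a stack of partial
assignments. Those of equal length on the stack are siblings, which bounds its size; and
every nonempty assignment that is not a failure has a child, which bounds the delay by
the time of n + O(1) propagations.

Soundness: at a leaf all the domains but the last one are singletons, so that arc
consistency forces every base view to contain the tuple of the assignment. Connectedness
ensures that no view is empty unless all are. Completeness: a homomorphism agreeing with
the current assignment is never removed by propagation.

Failures: if a tree projection exists, a value of X_i that survives propagation extends
along the join tree, one hyperedge after another, to a homomorphism; it agrees with the
values chosen before, and so keeps the next call from failing. *)

Require Import Defs.
From mathcomp Require Import all_boot all_order all_algebra.
From mathcomp Require Import zify.

Set Implicit Arguments.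
Unset Strict Implicit.
Unset Printing Implicit Defensive.

Import GRing.Theory.

(** * Polynomial time on the tree machine *)

Definition polynomial (f : nat -> nat) : Prop :=
  exists p : {poly nat}, forall n, f n = (p.[n])%R.

Lemma polynomial_const c : polynomial (fun=> c).
Proof. by exists (polyC c) => n; rewrite hornerC. Qed.

Lemma polynomial_id : polynomial id.
Proof. by exists 'X%R => n; rewrite hornerX. Qed.

Lemma polynomialD f g :
  polynomial f -> polynomial g -> polynomial (fun n => f n + g n).
Proof. by case=> p hp [q hq]; exists (p + q)%R => n; rewrite hornerD hp hq. Qed.

Lemma polynomialM f g :
  polynomial f -> polynomial g -> polynomial (fun n => f n * g n).
Proof. by case=> p hp [q hq]; exists (p * q)%R => n; rewrite hornerM hp hq. Qed.

Lemma polynomial_comp f g :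
  polynomial f -> polynomial g -> polynomial (fun n => f (g n)).
Proof.
by case=> p hp [q hq]; exists (p \Po q)%R => n; rewrite horner_comp hp hq.
Qed.

Lemma polynomialS f : polynomial f -> polynomial (fun n => (f n).+1).
Proof. by case=> p hp; exists (1 + p)%R => n; rewrite hornerD hornerC hp. Qed.

Lemma polynomial_mono f m n : polynomial f -> m <= n -> f m <= f n.
Proof.
case=> p hp mn; rewrite !hp; elim/poly_ind: p {hp} => [|p c IH].
  by rewrite !horner0.
rewrite !hornerD !hornerM !hornerC !hornerX.
exact: leq_add (leq_mul IH mn) (leqnn _).
Qed.

Ltac poly := repeat first
  [ assumption | exact: polynomial_id | exact: polynomial_const
  | apply: polynomialS | apply: polynomialD | apply: polynomialM
  | match goal with |- polynomial (fun x => ?f (@?g x)) =>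
      apply: (@polynomial_comp f g) end ].

Lemma tree_size_gt0 x : 0 < tree_size x.
Proof. by case: x. Qed.

Lemma size_tick k : size (tick k) = k.
Proof. exact: size_nseq. Qed.

Lemma tickD j k : tick (j + k) = tick j ++ tick k.
Proof. by rewrite /tick nseqD. Qed.

Lemma eval_size P x y l :
  eval P x y l -> tree_size x <= size l /\ tree_size y <= size l.
Proof.
elim=> {P x y l}; move=> *; rewrite ?size_rcons ?size_cat ?size_tick;
  try (simpl tree_size in *; lia).
- by split=> //; exact: tree_size_gt0.
- by split=> //=; match goal with |- context [tree_size ?x] => have := tree_size_gt0 x; lia end.
Qed.

Lemma eval_inj P x y l : eval P x y l ->
  forall y' l', eval P x y' l' -> y = y' /\ l = l'.
Proof.
elim=> {P x y l}; try by move=> *; match goal with H : eval _ _ _ _ |- _ =>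
  inversion H; subst end.
- move=> P Q x y z l1 l2 _ IH1 _ IH2 y' l' H; inversion H; subst.
  by have [-> ->] := IH1 _ _ H2; have [-> ->] := IH2 _ _ H6.
- move=> P Q x y z l1 l2 _ IH1 _ IH2 y' l' H; inversion H; subst.
  have [? ->] := IH1 _ _ H2; subst.
  by have [-> ->] := IH2 _ _ H6.
- move=> C P Q x u v y l1 l2 _ IH1 _ IH2 y' l' H; inversion H; subst.
    have [_ ->] := IH1 _ _ H6.
    by have [-> ->] := IH2 _ _ H7.
  by have [] := IH1 _ _ H6.
- move=> C P Q x y l1 l2 _ IH1 _ IH2 y' l' H; inversion H; subst.
    by have [] := IH1 _ _ H6.
  have [_ ->] := IH1 _ _ H6.
  by have [-> ->] := IH2 _ _ H7.
- move=> C P x l _ IH y' l' H; inversion H; subst.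
    by have [_ ->] := IH _ _ H5.
  by have [] := IH _ _ H2.
- move=> C P x u v y z l1 l2 l3 _ IH1 _ IH2 _ IH3 y' l' H; inversion H; subst.
    by have [] := IH1 _ _ H5.
  have [_ ->] := IH1 _ _ H2; have [? ->] := IH2 _ _ H3; subst.
  by have [-> ->] := IH3 _ _ H7.
Qed.

Class encoding (T : Type) := Encoding { enc : T -> tree; enc_inj : injective enc }.

Definition ptimeD T U `{encoding T, encoding U} (D : T -> Prop) (f : T -> U) :=
  exists P b, polynomial b /\ forall x, D x ->
    exists2 k, eval P (enc x) (enc (f x)) (tick k) & k <= b (tree_size (enc x)).

Notation ptime f := (ptimeD (fun=> True) f).

Lemma enc_nat_inj : injective enc_nat.
Proof. by elim=> [|m IH] [|n] //= [] /IH->. Qed.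
#[export] Instance encoding_nat : encoding nat := Encoding enc_nat_inj.

Definition enc_bool (b : bool) : tree := if b then Node Leaf Leaf else Leaf.
Lemma enc_bool_inj : injective enc_bool. Proof. by do 2!case. Qed.
#[export] Instance encoding_bool : encoding bool := Encoding enc_bool_inj.

Lemma enc_unit_inj : injective (fun _ : unit => Leaf). Proof. by do 2!case. Qed.
#[export] Instance encoding_unit : encoding unit := Encoding enc_unit_inj.

Lemma enc_pair_inj T U (eT : T -> tree) (eU : U -> tree) :
  injective eT -> injective eU -> injective (enc_pair eT eU).
Proof. by move=> iT iU [x y] [x' y'] /= [] /iT-> /iU->. Qed.
#[export] Instance encoding_pair T U `{encoding T, encoding U} :
  encoding (T * U) := Encoding (enc_pair_inj enc_inj enc_inj).

Lemma enc_seq_inj T (eT : T -> tree) : injective eT -> injective (enc_seq eT).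
Proof. by move=> iT; elim=> [|x s IH] [|y t] //= [] /iT-> /IH->. Qed.
#[export] Instance encoding_seq T `{encoding T} : encoding (seq T) :=
  Encoding (enc_seq_inj enc_inj).

Lemma enc_symbol_inj : injective enc_symbol.
Proof. by case=> x [] y //= [] /enc_nat_inj->. Qed.
#[export] Instance encoding_symbol : encoding symbol := Encoding enc_symbol_inj.

Lemma enc_view_symbol_inj : injective enc_view_symbol.
Proof.
case=> [R t|x] [R' t'|y] //= []; last by move/enc_nat_inj->.
by move/enc_symbol_inj-> => /(enc_seq_inj enc_nat_inj)->.
Qed.
#[export] Instance encoding_view_symbol : encoding view_symbol :=
  Encoding enc_view_symbol_inj.

Lemma enc_structure_inj S (eS : S -> tree) :
  injective eS -> injective (enc_structure eS).
Proof.
move=> iS [n r] [n' r'] [] /enc_nat_inj->.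
have iN := enc_seq_inj (enc_seq_inj enc_nat_inj).
by move/(enc_seq_inj (enc_pair_inj (enc_pair_inj iS enc_nat_inj) iN))->.
Qed.
#[export] Instance encoding_structure S `{encoding S} : encoding (structure S) :=
  Encoding (enc_structure_inj enc_inj).

Definition enc_option T (eT : T -> tree) (o : option T) : tree :=
  if o is Some x then Node Leaf (eT x) else Leaf.
Lemma enc_option_inj T (eT : T -> tree) :
  injective eT -> injective (enc_option eT).
Proof. by move=> iT [x|] [y|] //= [] /iT->. Qed.
#[export] Instance encoding_option T `{encoding T} : encoding (option T) :=
  Encoding (enc_option_inj enc_inj).

Lemma enc_instance_inj : injective enc_instance.
Proof.
have iS := enc_structure_inj enc_symbol_inj.
have iO := enc_seq_inj enc_nat_inj.
move=> [A B O] [A' B' O'].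
by move/(@enc_pair_inj _ _ _ _ (enc_pair_inj iS iS) iO (A, B, O) (A', B', O'))
  => [-> -> ->].
Qed.
#[export] Instance encoding_instance : encoding instance :=
  Encoding enc_instance_inj.

Notation tsize x := (tree_size (enc x)).

Lemma ptime_size T U `{encoding T, encoding U} D (f : T -> U) : ptimeD D f ->
  exists b, polynomial b /\ forall x, D x -> tsize (f x) <= b (tsize x).
Proof.
case=> P [b] [pb hP]; exists b; split=> // x /hP [k /eval_size[_]].
by rewrite size_tick; apply: leq_trans.
Qed.

Lemma ptimeW T U `{encoding T, encoding U} (D D' : T -> Prop) (f : T -> U) :
  (forall x, D x -> D' x) -> ptimeD D' f -> ptimeD D f.
Proof. by move=> DD' [P [b [pb hP]]]; exists P, b; split=> // x /DD'/hP. Qed.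

Lemma polytime_ptime T U `{encoding T, encoding U} D (f : T -> U) :
  ptimeD D f <-> polytime D enc enc f.
Proof.
split=> [[P [b [[p hp] hP]]]|[P [p hP]]].
  by exists P, p => x /hP; rewrite hp.
by exists P, (fun n => p.[n]%R); split=> //; exists p.
Qed.

Lemma ptime_eq T U V `{encoding T, encoding U, encoding V} D (f : T -> U) (g : T -> V) :
  (forall x, enc (f x) = enc (g x)) -> ptimeD D f -> ptimeD D g.
Proof.
by move=> fg [P [b [pb hP]]]; exists P, b; split=> // x /hP; rewrite fg.
Qed.

Section Closure.
Context {E : Type} {eE : encoding E}.
Variable D : E -> Prop.

Lemma ptime_id : ptimeD D (fun e => e).
Proof.
exists PId, id; split; first by poly.
by move=> x _; exists (tsize x) => //; constructor.
Qed.

Lemma ptime_comp T U `{encoding T, encoding U} (D' : T -> Prop)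
    (f : E -> T) (g : T -> U) :
  ptimeD D f -> ptimeD D' g -> (forall e, D e -> D' (f e)) ->
  ptimeD D (fun e => g (f e)).
Proof.
move=> [P [b [pb hP]]] [Q [c [pc hQ]]] DD'.
exists (PComp P Q), (fun n => b n + c (b n)); split; first by poly.
move=> x Dx; have [k ek lk] := hP x Dx; have [j ej lj] := hQ _ (DD' x Dx).
exists (k + j); first by rewrite tickD; apply: ev_comp ek ej.
apply: leq_add => //; apply: leq_trans lj _; apply: polynomial_mono => //.
by apply: leq_trans lk; have [_] := eval_size ek; rewrite size_tick.
Qed.

Lemma ptime_pair T U `{encoding T, encoding U} (f : E -> T) (g : E -> U) :
  ptimeD D f -> ptimeD D g -> ptimeD D (fun e => (f e, g e)).
Proof.
move=> [P [b [pb hP]]] [Q [c [pc hQ]]].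
exists (PPair P Q), (fun n => n + (b n + (c n + (b n + c n).+1))).
split; first by poly.
move=> x Dx; have [k ek lk] := hP x Dx; have [j ej lj] := hQ x Dx.
exists (tsize x + (k + (j + tsize (f x, g x)))).
  by rewrite !tickD; apply: ev_pair.
rewrite leq_add2l; apply: leq_add => //; apply: leq_add => //=.
have [_] := eval_size ek; have [_] := eval_size ej; rewrite !size_tick; lia.
Qed.

Lemma ptime_if T `{encoding T} (b : E -> bool) (f g : E -> T) :
  ptimeD D b -> ptimeD D f -> ptimeD D g ->
  ptimeD D (fun e => if b e then f e else g e).
Proof.
move=> [B [d [pd hB]]] [P [p [pp hP]]] [Q [q [pq hQ]]].
exists (PIf B P Q), (fun n => n + (d n + (p n + q n))); split; first by poly.
move=> x Dx; have [i ei li] := hB x Dx; have [k ek lk] := hP x Dx.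
have [j ej lj] := hQ x Dx; case: (b x) ei => ei.
  exists (tsize x + (i + k)); last by lia.
  by rewrite !tickD; apply: ev_if_true ei ek.
exists (tsize x + (i + j)); last by lia.
by rewrite !tickD; apply: ev_if_false ei ej.
Qed.

Lemma ptime_eqb (T : eqType) `{encoding T} (f g : E -> T) :
  ptimeD D f -> ptimeD D g -> ptimeD D (fun e => f e == g e).
Proof.
move=> hf hg; have hfg := ptime_pair hf hg.
apply: (ptime_comp (D' := fun=> True) (g := fun p : T * T => p.1 == p.2) hfg) => //.
exists PEq, id; split; first by poly.
move=> [x y] _; exists (tsize (x, y)) => //; rewrite /fst /snd.
case: eqP => [->|nxy]; first exact: ev_eq_true.
by apply: ev_eq_false => h; apply: nxy; exact: enc_inj h.
Qed.

End Closure.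

Lemma ptime_prog T U `{encoding T, encoding U} (f : T -> U) P c :
  (forall x, exists2 k, eval P (enc x) (enc (f x)) (tick k) & k <= c * tsize x) ->
  ptime f.
Proof.
by move=> hP; exists P, (fun n => c * n); split=> [|x _]; [poly | exact: hP].
Qed.

Lemma enc_tree_inj : injective (fun x : tree => x). Proof. by []. Qed.
#[export] Instance encoding_tree : encoding tree := Encoding enc_tree_inj.

Lemma enc_nat_nseq n : enc_nat n = enc (nseq n tt).
Proof. by elim: n => //= n ->. Qed.

Section Basic.
Context {E : Type} {eE : encoding E}.
Variable D : E -> Prop.

Lemma ptime_const T `{encoding T} (c : T) : ptimeD D (fun _ : E => c).
Proof.
have hc : forall t : tree, ptimeD D (fun _ : E => t).
  elim=> [|t ht u hu].
    exists PLeaf, id; split=> [|x _]; first by poly.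
    by exists (tsize x) => //; constructor.
  exact: (ptime_eq _ (ptime_pair ht hu)).
exact: (ptime_eq _ (hc (enc c))).
Qed.

Lemma ptime_fst T U `{encoding T, encoding U} (f : E -> T * U) :
  ptimeD D f -> ptimeD D (fun e => (f e).1).
Proof.
move=> hf; apply: (ptime_comp (D' := fun=> True) hf) => //.
apply: (@ptime_prog _ _ _ _ _ PFst 1) => -[x y]; exists (tsize (x, y)); last by lia.
exact: ev_fst.
Qed.

Lemma ptime_snd T U `{encoding T, encoding U} (f : E -> T * U) :
  ptimeD D f -> ptimeD D (fun e => (f e).2).
Proof.
move=> hf; apply: (ptime_comp (D' := fun=> True) hf) => //.
apply: (@ptime_prog _ _ _ _ _ PSnd 1) => -[x y]; exists (tsize (x, y)); last by lia.
exact: ev_snd.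
Qed.

Lemma ptime_cons T `{encoding T} (f : E -> T) (g : E -> seq T) :
  ptimeD D f -> ptimeD D g -> ptimeD D (fun e => f e :: g e).
Proof. by move=> hf hg; apply: (ptime_eq _ (ptime_pair hf hg)). Qed.

Lemma ptime_some T `{encoding T} (f : E -> T) :
  ptimeD D f -> ptimeD D (fun e => Some (f e)).
Proof.
by move=> hf; apply: (ptime_eq _ (ptime_pair (ptime_const Leaf) hf)).
Qed.

Lemma ptime_structure S `{encoding S} (f : E -> nat) g :
  ptimeD D f -> ptimeD D g -> ptimeD D (fun e => @Structure S (f e) (g e)).
Proof. by move=> hf hg; apply: (ptime_eq _ (ptime_pair hf hg)). Qed.

Lemma ptime_univ S `{encoding S} (f : E -> structure S) :
  ptimeD D f -> ptimeD D (fun e => univ (f e)).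
Proof.
move=> hf; have hg : ptimeD D (fun e => (univ (f e), rels (f e))).
  by apply: ptime_eq hf => e; case: (f e).
exact: (ptime_fst hg).
Qed.

Lemma ptime_rels S `{encoding S} (f : E -> structure S) :
  ptimeD D f -> ptimeD D (fun e => rels (f e)).
Proof.
move=> hf; have hg : ptimeD D (fun e => (univ (f e), rels (f e))).
  by apply: ptime_eq hf => e; case: (f e).
exact: (ptime_snd hg).
Qed.

Lemma ptime_instance (f : E -> instance) : ptimeD D f ->
  [/\ ptimeD D (fun e => lhs (f e)), ptimeD D (fun e => rhs (f e))
    & ptimeD D (fun e => outv (f e))].
Proof.
move=> hf; have hg : ptimeD D (fun e => ((lhs (f e), rhs (f e)), outv (f e))).
  by apply: ptime_eq hf => e; case: (f e).
split; last exact: (ptime_snd hg).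
- exact: (ptime_fst (ptime_fst hg)).
- exact: (ptime_snd (ptime_fst hg)).
Qed.

Lemma ptime_Dom (f : E -> nat) : ptimeD D f -> ptimeD D (fun e => Dom (f e)).
Proof.
move=> hf.
by apply: (ptime_eq _ (ptime_pair (ptime_const (Node Leaf Leaf)) hf)).
Qed.

Lemma ptime_dom_view (f : E -> nat) :
  ptimeD D f -> ptimeD D (fun e => dom_view (f e)).
Proof.
move=> hf; have h1 := ptime_cons hf (ptime_const [::]).
by apply: (ptime_eq _ (ptime_pair (ptime_const Leaf) (ptime_pair (ptime_Dom hf) h1))).
Qed.

Lemma ptime_nilp T `{encoding T} (f : E -> seq T) :
  ptimeD D f -> ptimeD D (fun e => nilp (f e)).
Proof.
move=> hf; apply: (ptime_comp (D' := fun=> True) hf) => //.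
apply: (@ptime_prog _ _ _ _ _ (PIf PId PLeaf (PPair PLeaf PLeaf)) 8) => -[|x s].
  exists (1 + (1 + (1 + (1 + (1 + 3))))) => //.
  by rewrite !tickD; apply: ev_if_false; do ?constructor.
exists (tsize (x :: s) + (tsize (x :: s) + tsize (x :: s))); last by lia.
by rewrite !tickD; apply: ev_if_true; do ?constructor.
Qed.

Lemma ptime_head T `{encoding T} (f : E -> T) (g : E -> seq T) :
  ptimeD D f -> ptimeD D g -> ptimeD D (fun e => head (f e) (g e)).
Proof.
move=> hf hg.
apply: (ptime_comp (D' := fun=> True) (g := fun p => head p.1 p.2) (ptime_pair hf hg)) => //.
apply: (@ptime_prog _ _ _ _ _ (PIf PSnd (PComp PSnd PFst) PFst) 4) => -[x [|y s]].
  exists (tsize (x, @nil T) + (tsize (x, @nil T) + tsize (x, @nil T))); last by lia.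
  by rewrite !tickD; apply: ev_if_false; constructor.
exists (tsize (x, y :: s) + (tsize (x, y :: s) + (tsize (x, y :: s) + tsize (y :: s)))).
  2: by rewrite /=; lia.
rewrite !tickD; apply: ev_if_true; first by constructor.
by apply: ev_comp; constructor.
Qed.

Lemma ptime_behead T `{encoding T} (f : E -> seq T) :
  ptimeD D f -> ptimeD D (fun e => behead (f e)).
Proof.
move=> hf; apply: (ptime_comp (D' := fun=> True) hf) => //.
apply: (@ptime_prog _ _ _ _ _ PSnd 1) => -[|x s].
  by exists 1; first by constructor.
exists (tsize (x :: s)); last by lia.
by constructor.
Qed.

Lemma ptime_nseq_tt (f : E -> nat) :
  ptimeD D f -> ptimeD D (fun e => nseq (f e) tt).
Proof. by move=> hf; apply: ptime_eq hf => e; exact: enc_nat_nseq. Qed.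

End Basic.

Lemma tsize_seq T `{encoding T} (s : seq T) :
  tsize s = (sumn [seq tsize x | x <- s] + size s).+1.
Proof. by elim: s => //= x s ->; rewrite /enc /=; lia. Qed.

Lemma tsize_catrev T `{encoding T} (s t : seq T) :
  (tsize (catrev s t)).+1 = tsize s + tsize t.
Proof.
by rewrite !tsize_seq catrevE map_cat map_rev sumn_cat sumn_rev size_cat size_rev; lia.
Qed.

Lemma size_le_tsize T `{encoding T} (s : seq T) : size s < tsize s.
Proof. by rewrite tsize_seq; lia. Qed.

Section Foldl.
Context {E S T : Type} {eE : encoding E} {eS : encoding S} {eT : encoding T}.
Variables (D : E -> Prop) (g : E -> S -> T -> S) (s0 : E -> S) (l : E -> seq T).

Lemma ptime_foldl :
  ptime (fun p : E * (S * T) => g p.1 p.2.1 p.2.2) ->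
  ptimeD D s0 -> ptimeD D l ->
  (exists2 b, polynomial b & forall e l1 l2, D e -> l e = l1 ++ l2 ->
     tsize (foldl (g e) (s0 e) l1) <= b (tsize e)) ->
  ptimeD D (fun e => foldl (g e) (s0 e) (l e)).
Proof.
move=> [G [bG [pG hG]]] hs hl [b pb hb].
have [bl [pl hbl]] := ptime_size hl.
pose h e := foldl (g e) (s0 e) (l e).
have hi := ptime_pair (ptime_id D) (ptime_pair hl hs).
pose body := PPair PFst (PPair (PComp (PComp PSnd PFst) PSnd)
  (PComp (PPair PFst (PPair (PComp PSnd PSnd) (PComp (PComp PSnd PFst) PFst))) G)).
pose W := PWhile (PComp PSnd PFst) body.
pose sb n := (n + (bl n + b n)).+3.
pose stepb n := 40 * sb n + bG (sb n + sb n) + b n.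
have pstep : polynomial stepb by rewrite /stepb /sb; poly.
have hW : exists W' b', polynomial b' /\ forall e, D e ->
    exists2 k, eval W' (enc (e, (l e, s0 e))) (enc (e, (@nil T, h e))) (tick k)
      & k <= b' (tsize e); last first.
  have hW' : ptimeD D (fun e => (e, (@nil T, h e))).
    case: hi => P [bp [pp hP]]; case: hW => W' [b' [pb' hW]].
    exists (PComp P W'), (fun n => bp n + b' n); split=> [|e De]; first by poly.
    have [k ek lk] := hP e De; have [j ej lj] := hW e De.
    by exists (k + j); [rewrite tickD; apply: ev_comp ek ej | lia].
  exact: (ptime_snd (ptime_snd hW')).
exists W, (fun n => (bl n).+1 * stepb n); split=> [|e De]; first by poly.
have main : forall l0 s, (exists l1, l e = l1 ++ l0 /\ foldl (g e) (s0 e) l1 = s) ->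
    tsize l0 <= bl (tsize e) ->
    exists2 k, eval W (enc (e, (l0, s))) (enc (e, ([::], foldl (g e) s l0))) (tick k)
      & k <= (size l0).+1 * stepb (tsize e); last first.
  have [||k ek lk] := main (l e) (s0 e); [by exists [::] | exact: hbl |].
  exists k => //; apply: leq_trans lk _; rewrite leq_mul2r; apply/orP; right.
  by rewrite ltnS; apply: leq_trans (ltnW (size_le_tsize _)) (hbl e De).
have hst : tsize e <= sb (tsize e) by rewrite /sb; lia.
elim=> [|x l0 IH] s [l1 [E1 E2]] hl0.
  have ss : tsize (e, (@nil T, s)) <= sb (tsize e).
    have := hb e l1 _ De E1; rewrite E2 /sb /=; lia.
  exists (tsize (e, (@nil T, s)) + (tsize (e, (@nil T, s)) + tsize (@nil T, s))).
    rewrite !tickD; apply: ev_while_stop.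
    by apply: (ev_comp (y := enc (@nil T, s))); constructor.
  by move: ss; rewrite mul1n /stepb /=; lia.
have [||j ej lj] := IH (g e s x).
- by exists (rcons l1 x); rewrite foldl_rcons E2 cat_rcons.
- by move: hl0 => /=; lia.
have hs1 : tsize s <= b (tsize e) by rewrite -E2; apply: hb E1.
have hs2 : tsize (g e s x) <= b (tsize e).
  by rewrite -E2 -foldl_rcons; apply: (hb _ _ l0); rewrite // E1 cat_rcons.
have [i ei li] := hG (e, (s, x)) I.
pose ee := @enc E eE e; pose el := enc_seq (@enc T eT) l0; pose ex := @enc T eT x.
pose es := @enc S eS s; pose eg := @enc S eS (g e s x).
pose z2 := Node ex el; pose z1 := Node z2 es; pose z0 := Node ee z1.
pose z3 := Node es ex; pose z4 := Node ee z3; pose z5 := Node el eg.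
pose z6 := Node ee z5.
have sz0 : tree_size z0 <= sb (tsize e).
  by move: hl0 hs1; rewrite /z0 /z1 /z2 /sb /= -/ee -/es -/ex -/el; lia.
pose bk := tree_size z0 + (tree_size z0 + (
  (tree_size z0 + ((tree_size z0 + tree_size z1) + tree_size z2 +
   (((tree_size z0 + (tree_size z0 + ((tree_size z0 + ((tree_size z0 + tree_size z1)
     + (((tree_size z0 + tree_size z1) + tree_size z2) + tree_size z3))) + tree_size z4))) + i)
    + tree_size z5))) + tree_size z6)).
have [body_k ebody hbk] : exists2 k, eval body z0 z6 (tick k) & k = bk.
  exists bk; rewrite // /bk !tickD; apply: ev_pair; first by constructor.
  apply: ev_pair; first by (apply: ev_comp; first apply: ev_comp; constructor).
  apply: ev_comp ei; apply: ev_pair; first by constructor.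
  apply: ev_pair; first by apply: ev_comp; constructor.
  by apply: ev_comp; first apply: ev_comp; constructor.
exists (tree_size z0 + ((tree_size z0 + tree_size z1) + (body_k + j))).
  rewrite !tickD; apply: (ev_while_step (u := ex) (v := el)) ebody ej.
  by apply: ev_comp; constructor.
rewrite [size _]/= mulSn; move: lj; set A := _ * _ => lj.
have hi2 : i <= bG (sb (tsize e) + sb (tsize e)).
  apply: leq_trans li _; apply: polynomial_mono => //.
  by change (tree_size z4 <= sb (tsize e) + sb (tsize e)); rewrite /z4 /z3; move: sz0;
    rewrite /z0 /z1 /z2 /=; lia.
have : [/\ tree_size z1 <= tree_size z0, tree_size z2 <= tree_size z0,
  tree_size z3 <= tree_size z0 & tree_size z4 <= tree_size z0 ].
  by rewrite /z1 /z2 /z3 /z4 /z0 /=; split; lia.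
have : tree_size z5 + tree_size z6 <= 2 * tree_size z0 + 2 * b (tsize e) + 2.
  move: hs2; rewrite -[tsize (g e s x)]/(tree_size eg) /z6 /z5 /z0 /z1 /z2 /=; lia.
have : b (tsize e) <= sb (tsize e) by rewrite /sb; lia.
move=> q1 q2 [q3 q4 q5 q6]; rewrite hbk /bk /stepb; have := tree_size_gt0 z0; lia.
Qed.

End Foldl.

Lemma tsize_catl T `{encoding T} (s t : seq T) : tsize s <= tsize (s ++ t).
Proof. by rewrite !tsize_seq map_cat sumn_cat size_cat; lia. Qed.

Section Lists.
Context {E : Type} {eE : encoding E}.
Variable D : E -> Prop.

Lemma ptime_ext T `{encoding T} (f g : E -> T) :
  f =1 g -> ptimeD D f -> ptimeD D g.
Proof. by move=> fg; apply: ptime_eq => x; rewrite fg. Qed.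

Lemma ptime_catrev T `{encoding T} (f g : E -> seq T) :
  ptimeD D f -> ptimeD D g -> ptimeD D (fun e => catrev (f e) (g e)).
Proof.
move=> hf hg; have catrevE (s t : seq T) : catrev s t = foldl (fun acc x => x :: acc) t s.
  by elim: s t => //= x s IH t.
apply: (ptime_ext (fun e => esym (catrevE (f e) (g e)))).
apply: (@ptime_foldl _ _ _ _ _ _ D (fun _ acc x => x :: acc)) => //.
  apply: ptime_cons; first exact: (ptime_snd (ptime_snd (ptime_id _))).
  exact: (ptime_fst (ptime_snd (ptime_id _))).
have [b1 [p1 h1]] := ptime_size hf; have [b2 [p2 h2]] := ptime_size hg.
exists (fun n => b1 n + b2 n) => [|e l1 l2 De fE]; first by poly.
rewrite -catrevE -ltnS tsize_catrev; apply: leqW; apply: leq_add (h2 e De).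
by apply: leq_trans (h1 e De); rewrite fE; exact: tsize_catl.
Qed.

Lemma ptime_rev T `{encoding T} (f : E -> seq T) :
  ptimeD D f -> ptimeD D (fun e => rev (f e)).
Proof. by move=> hf; exact: ptime_catrev hf (ptime_const _ _). Qed.

Lemma ptime_cat T `{encoding T} (f g : E -> seq T) :
  ptimeD D f -> ptimeD D g -> ptimeD D (fun e => f e ++ g e).
Proof.
move=> hf hg; apply: ptime_ext (ptime_catrev (ptime_rev hf) hg) => e.
by rewrite catrevE revK.
Qed.
End Lists.

Section FlatMap.
Context {E T U : Type} {eE : encoding E} {eT : encoding T} {eU : encoding U}.
Variables (D : E -> Prop) (g : E -> T -> seq U) (l : E -> seq T).

Lemma ptime_flatmap : ptime (fun p : E * T => g p.1 p.2) -> ptimeD D l ->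
  ptimeD D (fun e => flatten [seq g e x | x <- l e]).
Proof.
move=> hg hl; pose h e acc x := catrev (g e x) acc.
have hE e : rev (foldl (h e) [::] (l e)) = flatten [seq g e x | x <- l e].
  suff hh s acc : foldl (h e) acc s = catrev (flatten [seq g e x | x <- s]) acc.
    by rewrite hh /= -/(rev _) revK.
  by elim: s acc => //= x s IH acc; rewrite IH /h !catrevE rev_cat catA.
apply: (ptime_ext hE); apply: ptime_rev.
have [bg [pg hbg]] := ptime_size hg; have [bl [pl hbl]] := ptime_size hl.
apply: (@ptime_foldl _ _ _ _ _ _ D h) => //.
- apply: ptime_catrev; last exact: (ptime_fst (ptime_snd (ptime_id _))).
  apply: (ptime_comp (f := fun p => (p.1, p.2.2)) (g := fun p : E * T => g p.1 p.2)) hg _ => //.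
  apply: ptime_pair; first exact: (ptime_fst (ptime_id _)).
  exact: (ptime_snd (ptime_snd (ptime_id _))).
- exact: ptime_const.
exists (fun n => (bl n * bg (n + bl n)).+1) => [|e l1 l2 De lE]; first by poly.
have [B BE] : exists B, B = bg (tsize e + bl (tsize e)) by eexists.
have hB : forall s, (forall x, List.In x s -> List.In x (l e)) ->
    tsize (foldl (h e) [::] s) <= (size s * B).+1.
  elim/last_ind=> [|s x IH] sl //.
  rewrite foldl_rcons size_rcons mulSn -ltnS {1}/h tsize_catrev.
  have sx : tsize (g e x) <= B.
    rewrite BE; apply: leq_trans (hbg (e, x) I) _; apply: polynomial_mono => //=.
    have : tsize x < tsize (l e).
      have: List.In x (l e) by apply: sl; rewrite -cats1; apply: List.in_or_app; right; left.
      elim: (l e) => //= y t IHt [->|/IHt]; rewrite /=; lia.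
    have := hbl e De; lia.
  have : tsize (foldl (h e) [::] s) <= (size s * B).+1.
    by apply: IH => y ys; apply: sl; rewrite -cats1; apply: List.in_or_app; left.
  lia.
apply: leq_trans (hB l1 _) _.
  by move=> x xl1; rewrite lE; apply: List.in_or_app; left.
rewrite -BE ltnS leq_mul2r; apply/orP; right; apply: leq_trans (hbl e De).
by apply: ltnW; apply: leq_ltn_trans (size_le_tsize _); rewrite lE size_cat leq_addr.
Qed.

End FlatMap.

Section Comprehensions.
Context {E : Type} {eE : encoding E}.
Variable D : E -> Prop.

Lemma ptime_map T U `{encoding T, encoding U} (l : E -> seq T) (g : E -> T -> U) :
  ptimeD D l -> ptime (fun p : E * T => g p.1 p.2) ->
  ptimeD D (fun e => map (g e) (l e)).
Proof.
move=> hl hg.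
have h1 := ptime_flatmap (g := fun e x => [:: g e x]) (ptime_cons hg (ptime_const _ [::])) hl.
apply: ptime_ext h1 => e /=.
by elim: (l e) => //= x s ->.
Qed.

Lemma ptime_filter T `{encoding T} (l : E -> seq T) (g : E -> T -> bool) :
  ptimeD D l -> ptime (fun p : E * T => g p.1 p.2) ->
  ptimeD D (fun e => filter (g e) (l e)).
Proof.
move=> hl hg; have hs : ptime (fun p : E * T => if g p.1 p.2 then [:: p.2] else [::]).
  apply: ptime_if => //; last exact: ptime_const.
  by apply: ptime_cons (ptime_const _ _); apply: ptime_snd (ptime_id _).
have h1 := @ptime_flatmap E T T _ _ _ D (fun e x => if g e x then [:: x] else [::]) _ hs hl.
apply: ptime_ext h1 => e /=.
by elim: (l e) => //= x s ->; case: ifP.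
Qed.

Lemma ptime_flatten T `{encoding T} (l : E -> seq (seq T)) :
  ptimeD D l -> ptimeD D (fun e => flatten (l e)).
Proof.
move=> hl; have hs : ptime (fun p : E * seq T => p.2) by exact: ptime_snd (ptime_id _).
have h1 := @ptime_flatmap E (seq T) T _ _ _ D (fun _ x => x) _ hs hl.
by apply: ptime_ext h1 => e; rewrite map_id.
Qed.

Lemma ptime_neg (b : E -> bool) : ptimeD D b -> ptimeD D (fun e => ~~ b e).
Proof.
move=> hb; apply: ptime_ext (ptime_if hb (ptime_const _ false) (ptime_const _ true)) => e.
by case: (b e).
Qed.

Lemma ptime_and (b c : E -> bool) :
  ptimeD D b -> ptimeD D c -> ptimeD D (fun e => b e && c e).
Proof. by move=> hb hc; exact: ptime_if hb hc (ptime_const _ false). Qed.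

Lemma ptime_or (b c : E -> bool) :
  ptimeD D b -> ptimeD D c -> ptimeD D (fun e => b e || c e).
Proof. by move=> hb hc; exact: ptime_if hb (ptime_const _ true) hc. Qed.

Lemma ptime_imp (b c : E -> bool) :
  ptimeD D b -> ptimeD D c -> ptimeD D (fun e => b e ==> c e).
Proof. by move=> hb hc; exact: ptime_if hb hc (ptime_const _ true). Qed.
End Comprehensions.

Section Quantifiers.
Context {E : Type} {eE : encoding E}.
Variable D : E -> Prop.

Lemma ptime_all T `{encoding T} (l : E -> seq T) (g : E -> T -> bool) :
  ptimeD D l -> ptime (fun p : E * T => g p.1 p.2) ->
  ptimeD D (fun e => all (g e) (l e)).
Proof.
move=> hl hg; have h1 := ptime_filter (g := fun e x => ~~ g e x) hl (ptime_neg hg).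
apply: ptime_ext (ptime_nilp h1) => e.
by elim: (l e) => //= x s <-; case: (g e x).
Qed.

Lemma ptime_has T `{encoding T} (l : E -> seq T) (g : E -> T -> bool) :
  ptimeD D l -> ptime (fun p : E * T => g p.1 p.2) ->
  ptimeD D (fun e => has (g e) (l e)).
Proof.
move=> hl hg; have h1 := ptime_all (g := fun e x => ~~ g e x) hl (ptime_neg hg).
apply: ptime_ext (ptime_neg h1) => e.
by elim: (l e) => //= x s <-; case: (g e x).
Qed.

End Quantifiers.

Lemma ptime_on E T U `{encoding E, encoding T, encoding U} (f : E -> T) (g : T -> U) :
  ptime g -> ptime f -> ptime (fun e => g (f e)).
Proof. by move=> hg hf; apply: ptime_comp hf hg _. Qed.


Lemma ptime_mem E `{encoding E} (T : eqType) `{encoding T} (f : E -> T) (l : E -> seq T) :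
  ptime f -> ptime l -> ptime (fun e => f e \in l e).
Proof.
move=> hf hl; have h1 : ptime (fun p : E * T => p.2 == f p.1).
  apply: ptime_eqb; first exact: ptime_snd (ptime_id _).
  exact: ptime_on hf (ptime_fst (ptime_id _)).
apply: ptime_ext (ptime_has (g := fun e x => x == f e) hl h1) => e.
by rewrite -has_pred1.
Qed.

Lemma ptime_count E `{encoding E} T `{encoding T} (l : E -> seq T) :
  ptime l -> ptime (fun e => size (l e)).
Proof.
move=> hl; apply: (ptime_eq _ (ptime_map (g := fun _ _ => tt) hl (ptime_const _ tt))) => e.
by elim: (l e) => //= x s; rewrite /enc /= => ->.
Qed.

Lemma ptime_succ E `{encoding E} (f : E -> nat) : ptime f -> ptime (fun e => (f e).+1).
Proof. by move=> hf; apply: (ptime_eq _ (ptime_pair (ptime_const _ Leaf) hf)). Qed.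

Lemma tsize_nat n : tsize n = n.*2.+1.
Proof. by elim: n => //= n IH; rewrite /enc /= in IH *; rewrite IH; lia. Qed.

Lemma ptime_iota E `{encoding E} (f : E -> nat) : ptime f -> ptime (fun e => iota 0 (f e)).
Proof.
move=> hf; pose h (acc : seq nat) (_ : unit) := size acc :: acc.
have hE n : foldl h [::] (nseq n tt) = rev (iota 0 n).
  elim: n => // n IH; rewrite -addn1 nseqD iotaD foldl_cat IH rev_cat /=.
  by rewrite /h size_rev size_iota.
apply: (@ptime_ext _ _ _ _ _ (fun e => rev (foldl h [::] (nseq (f e) tt)))).
  by move=> e; rewrite hE revK.
apply: ptime_rev; apply: (@ptime_foldl _ _ _ _ _ _ _ (fun _ => h)).
- have h1 : ptime (fun p : E * (seq nat * unit) => p.2.1).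
    exact: ptime_fst (ptime_snd (ptime_id _)).
  exact: ptime_cons (ptime_count h1) h1.
- exact: ptime_const.
- exact: ptime_nseq_tt.
have [b [pb hb]] := ptime_size hf.
exists (fun n => (b n * (b n * 2).+2).+1) => [|e l1 l2 _ /esym lE]; first by poly.
have hn : size l1 + size l2 = f e by rewrite -size_cat lE size_nseq.
have -> : l1 = nseq (size l1) tt by elim: (l1) => //= -[] s <-.
rewrite hE tsize_seq size_rev size_iota map_rev sumn_rev.
have := hb e I; rewrite tsize_nat => hfe.
have : sumn [seq tsize x | x <- iota 0 (size l1)] <=
    size l1 * (b (tsize e) * 2).+1; last first.
  have hle : size l1 <= b (tsize e) by lia.
  move=> h2; rewrite ltnS; apply: leq_trans (leq_add h2 (leqnn _)) _.
  by rewrite -mulnSr leq_mul2r hle orbT.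
have : all (fun x => x < f e) (iota 0 (size l1)).
  by apply/allP => x; rewrite mem_iota; lia.
rewrite -{3}(size_iota 0 (size l1)).
elim: (iota _ _) => //= x s IH /andP [xf /IH]; rewrite tsize_nat; lia.
Qed.

Lemma ptime_ltn E `{encoding E} (f g : E -> nat) :
  ptime f -> ptime g -> ptime (fun e => f e < g e).
Proof.
move=> hf hg; apply: ptime_ext (ptime_mem hf (ptime_iota hg)) => e.
by rewrite mem_iota.
Qed.

Lemma ptime_rcons E `{encoding E} T `{encoding T} (f : E -> seq T) (g : E -> T) :
  ptime f -> ptime g -> ptime (fun e => rcons (f e) (g e)).
Proof.
move=> hf hg.
apply: ptime_ext (ptime_cat hf (ptime_cons hg (ptime_const _ [::]))) => e.
by rewrite cats1.
Qed.

Lemma ptime_drop E `{encoding E} T `{encoding T} (f : E -> nat) (l : E -> seq T) :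
  ptime f -> ptime l -> ptime (fun e => drop (f e) (l e)).
Proof.
move=> hf hl; pose h (acc : seq T) (_ : unit) := behead acc.
have hE n s : foldl h s (nseq n tt) = drop n s.
  by elim: n s => [|n IH] [|x s] //=; rewrite ?drop0 // IH.
apply: (ptime_ext (fun e => hE (f e) (l e))).
apply: (@ptime_foldl _ _ _ _ _ _ _ (fun _ => h)) => //.
- exact: ptime_behead (ptime_fst (ptime_snd (ptime_id _))).
- exact: ptime_nseq_tt.
have [b [pb hb]] := ptime_size hl; exists b => // e l1 _ _ _.
have -> : l1 = nseq (size l1) tt by elim: (l1) => //= -[] s <-.
rewrite hE; apply: leq_trans (hb e I).
by rewrite -{2}(cat_take_drop (size l1) (l e)) !tsize_seq map_cat sumn_cat size_cat; lia.
Qed.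

Lemma ptime_nth E `{encoding E} T `{encoding T} (x0 : T) (f : E -> nat) (l : E -> seq T) :
  ptime f -> ptime l -> ptime (fun e => nth x0 (l e) (f e)).
Proof.
move=> hf hl.
apply: ptime_ext (ptime_head (ptime_const _ x0) (ptime_drop hf hl)) => e.
by rewrite -nth0 nth_drop addn0.
Qed.

Lemma ptime_zip E `{encoding E} T `{encoding T} (s : E -> seq T) (t : E -> seq nat) :
  ptime s -> ptime t -> ptime (fun e => zip (s e) (t e)).
Proof.
move=> hs ht; pose h (p : seq nat * seq (T * nat)) x :=
  if nilp p.1 then p else (behead p.1, (x, head 0 p.1) :: p.2).
have hE a b acc : (foldl h (b, acc) a).2 = catrev (zip a b) acc.
  elim: a b acc => [|x a IH] [|y b] acc //=; last exact: IH.
  by rewrite [h _ _]/= IH; case: (a).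
apply: (@ptime_ext _ _ _ _ _ (fun e => rev (foldl h (t e, [::]) (s e)).2)).
  by move=> e; rewrite hE /= -/(rev _) revK.
apply: ptime_rev; apply: ptime_snd.
apply: (@ptime_foldl _ _ _ _ _ _ _ (fun _ => h)) => //.
- have hp : ptime (fun p : E * ((seq nat * seq (T * nat)) * T) => p.2.1).
    exact: ptime_fst (ptime_snd (ptime_id _)).
  have hx : ptime (fun p : E * ((seq nat * seq (T * nat)) * T) => p.2.2).
    exact: ptime_snd (ptime_snd (ptime_id _)).
  apply: ptime_if => //; first exact: ptime_nilp (ptime_fst hp).
  apply: ptime_pair; first exact: ptime_behead (ptime_fst hp).
  apply: ptime_cons (ptime_snd hp); apply: ptime_pair => //.
  exact: ptime_head (ptime_const _ _) (ptime_fst hp).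
- exact: ptime_pair ht (ptime_const _ _).
have [b [pb hb]] := ptime_size hs; have [c [pc hc]] := ptime_size ht.
exists (fun n => (b n + c n).+2) => [|e l1 l2 _ sE]; first by poly.
have hB : forall l b acc, tsize (foldl h (b, acc) l) <= tsize l + tsize (b, acc).
  elim=> [|x l IH] b' acc; first exact: leq_addl.
  case: b' => [|y b'']; first by apply: leq_trans (IH [::] acc) _; rewrite /=; lia.
  by apply: leq_trans (IH b'' ((x, y) :: acc)) _; rewrite /=; lia.
apply: leq_trans (hB l1 (t e) [::]) _.
have : tsize l1 <= tsize (l1 ++ l2) by exact: tsize_catl.
have := hb e I; have := hc e I; rewrite sE.
rewrite -[tsize (t e, _)]/((tsize (t e) + 1).+1). lia.
Qed.

Lemma ptime_take E `{encoding E} (f : E -> nat) (l : E -> seq nat) :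
  ptime f -> ptime l -> ptime (fun e => take (f e) (l e)).
Proof.
move=> hf hl.
have h1 : ptime (fun p : E * (unit * nat) => p.2.2).
  exact: ptime_snd (ptime_snd (ptime_id _)).
apply: ptime_ext (ptime_map (g := fun _ p => p.2) (ptime_zip (ptime_nseq_tt hf) hl) h1) => e.
by elim: (f e) (l e) => [|n IH] [|x s] //=; rewrite IH.
Qed.

Lemma ptime_interp E `{encoding E} (S : eqType) `{encoding S}
    (f : E -> structure S) (g : E -> S) :
  ptime f -> ptime g -> ptime (fun e => interp (f e) (g e)).
Proof.
move=> hf hg; apply: ptime_flatten; apply: ptime_map; last first.
  exact: ptime_snd (ptime_snd (ptime_id _)).
apply: ptime_filter; first exact: ptime_rels.
apply: ptime_eqb; first exact: ptime_fst (ptime_fst (ptime_snd (ptime_id _))).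
exact: ptime_on hg (ptime_fst (ptime_id _)).
Qed.

Lemma ptime_iter E `{encoding E} T U `{encoding T, encoding U}
    (g : E -> T -> T) (x : E -> T) (l : E -> seq U) :
  ptime (fun p : E * T => g p.1 p.2) -> (forall e y, tsize (g e y) <= tsize y) ->
  ptime x -> ptime l -> ptime (fun e => iter (size (l e)) (g e) (x e)).
Proof.
move=> hg gle hx hl.
have hE e (s : seq U) : foldl (fun y _ => g e y) (x e) s = iter (size s) (g e) (x e).
  by elim/last_ind: s => //= s y IH; rewrite foldl_rcons size_rcons IH.
apply: (ptime_ext (fun e => hE e (l e))).
apply: (@ptime_foldl _ _ _ _ _ _ _ (fun e y _ => g e y)) => //.
  apply: (ptime_comp (f := fun p => (p.1, p.2.1)) (g := fun p : E * T => g p.1 p.2)) hg _ => //.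
  apply: ptime_pair; first exact: (ptime_fst (ptime_id _)).
  exact: (ptime_fst (ptime_snd (ptime_id _))).
have [b [pb hb]] := ptime_size hx; exists b => // e l1 _ _ _; rewrite hE.
by apply: leq_trans (hb e I); elim: (size l1) => //= n IH; apply: leq_trans (gle _ _) IH.
Qed.



Ltac ptime_step := lazymatch goal with
  | |- ptimeD _ (fun _ => ?c) => exact: ptime_const
  | |- ptimeD _ (fun e => e) => exact: ptime_id
  | |- ptimeD _ fst => exact: ptime_fst (ptime_id _)
  | |- ptimeD _ snd => exact: ptime_snd (ptime_id _)
  | |- ptimeD _ (@univ _) => exact: ptime_univ (ptime_id _)
  | |- ptimeD _ (@rels _) => exact: ptime_rels (ptime_id _)
  | |- ptimeD _ (fun e => (_, _)) => apply: ptime_pair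
  | |- ptimeD _ (fun e => fst _) => apply: ptime_fst
  | |- ptimeD _ (fun e => snd _) => apply: ptime_snd
  | |- ptimeD _ (fun e => if _ then _ else _) => apply: ptime_if
  | |- ptimeD _ (fun e => eq_op _ _) => apply: ptime_eqb
  | |- ptimeD _ (fun e => cons _ _) => apply: ptime_cons
  | |- ptimeD _ (fun e => cat _ _) => apply: ptime_cat
  | |- ptimeD _ (fun e => rcons _ _) => apply: ptime_rcons
  | |- ptimeD _ (fun e => Some _) => apply: ptime_some
  | |- ptimeD _ (fun e => map _ _) => apply: ptime_map
  | |- ptimeD _ (fun e => filter _ _) => apply: ptime_filter
  | |- ptimeD _ (fun e => flatten _) => apply: ptime_flatten
  | |- ptimeD _ (fun e => all _ _) => apply: ptime_all
  | |- ptimeD _ (fun e => has _ _) => apply: ptime_has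
  | |- ptimeD _ (fun e => nilp _) => apply: ptime_nilp
  | |- ptimeD _ (fun e => negb _) => apply: ptime_neg
  | |- ptimeD _ (fun e => andb _ _) => apply: ptime_and
  | |- ptimeD _ (fun e => orb _ _) => apply: ptime_or
  | |- ptimeD _ (fun e => implb _ _) => apply: ptime_imp
  | |- ptimeD _ (fun e => in_mem _ _) => apply: ptime_mem
  | |- ptimeD _ (fun e => head _ _) => apply: ptime_head
  | |- ptimeD _ (fun e => nth _ _ _) => apply: ptime_nth
  | |- ptimeD _ (fun e => zip _ _) => apply: ptime_zip
  | |- ptimeD _ (fun e => take _ _) => apply: ptime_take
  | |- ptimeD _ (fun e => drop _ _) => apply: ptime_drop
  | |- ptimeD _ (fun e => iota 0 _) => apply: ptime_iota
  | |- ptimeD _ (fun e => size _) => apply: ptime_count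
  | |- ptimeD _ (fun e => leq (S _) _) => apply: ptime_ltn
  | |- ptimeD _ (fun e => S _) => apply: ptime_succ
  | |- ptimeD _ (fun e => univ _) => apply: ptime_univ
  | |- ptimeD _ (fun e => rels _) => apply: ptime_rels
  | |- ptimeD _ (fun e => Structure _ _) => apply: ptime_structure
  | |- ptimeD _ (fun e => interp _ _) => apply: ptime_interp
  | |- ptimeD _ (fun e => Dom _) => apply: ptime_Dom
  | |- ptimeD _ (fun e => dom_view _) => apply: ptime_dom_view
  end.
Ltac ptime_auto := repeat first [assumption | ptime_step].

(** * Generalized arc consistency *)

Section FilterRels.
Variable S : eqType.
Implicit Types (P : S -> seq nat -> bool) (A : structure S).

Lemma interpP A R t :
  reflect (exists2 r, r \in rels A & r.1.1 = R /\ t \in r.2) (t \in interp A R).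
Proof.
apply: (iffP flattenP) => [[ts /mapP [r rA ->] tr]|[r rA [rR tr]]].
  by move: rA; rewrite mem_filter => /andP [/eqP rR rA]; exists r.
by exists r.2 => //; apply/mapP; exists r => //; rewrite mem_filter rR eqxx.
Qed.

Lemma tuplesP A t :
  reflect (exists R, t \in interp A R) (t \in tuples A).
Proof.
apply: (iffP flattenP) => [[ts /mapP [r rA ->] tr]|[R /interpP [r rA [_ tr]]]].
  by exists r.1.1; apply/interpP; exists r.
by exists r.2 => //; apply: map_f.
Qed.

Lemma mem_symbols A R : (R \in symbols A) = has (fun r => r.1.1 == R) (rels A).
Proof.
rewrite /symbols /vocab -map_comp; apply/mapP/hasP => [[r rA ->]|[r rA /eqP <-]];
  by exists r => /=.
Qed.

Lemma interp_symbols A R t : t \in interp A R -> R \in symbols A.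
Proof.
by case/interpP => r rA [rR _]; rewrite mem_symbols; apply/hasP; exists r; rewrite ?rR.
Qed.

Definition filter_rels P A : structure S :=
  Structure (univ A) [seq (r.1, [seq t <- r.2 | P r.1.1 t]) | r <- rels A].

Lemma vocab_filter_rels P A : vocab (filter_rels P A) = vocab A.
Proof. by rewrite /vocab /= -map_comp; apply: eq_map. Qed.

Lemma interp_filter_rels P A R : interp (filter_rels P A) R = filter (P R) (interp A R).
Proof.
rewrite /interp /=; elim: (rels A) => //= r s IH.
by case: eqP => [e|_] //=; rewrite filter_cat IH e.
Qed.

Lemma size_filter_rels P A : size (tuples (filter_rels P A)) <= size (tuples A).
Proof.
rewrite /tuples /=; elim: (rels A) => //= r s IH; rewrite !size_cat.
by apply: leq_add => //; rewrite size_filter count_size.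
Qed.

Lemma filter_rels_fix P A :
  size (tuples A) <= size (tuples (filter_rels P A)) -> filter_rels P A = A.
Proof.
case: A => n rs; rewrite /filter_rels /tuples /= => h; congr Structure.
elim: rs h => //= r rs IH; rewrite !size_cat => h.
have h1 : size (filter (P r.1.1) r.2) <= size r.2 by rewrite size_filter count_size.
have h2 := size_filter_rels P (Structure n rs); rewrite /tuples /= in h2.
rewrite IH; last by have := leq_trans h (leq_add h1 (leqnn _)); rewrite leq_add2l.
congr (_ :: _); rewrite [RHS]surjective_pairing; congr (_, _).
apply/all_filterP; rewrite all_count -size_filter eqn_leq h1.
by have := leq_trans h (leq_add (leqnn _) h2); rewrite leq_add2r.
Qed.

Lemma filter_rels_all P A : filter_rels P A = A ->
  forall R t, t \in interp A R -> P R t.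
Proof.
move=> h R t; rewrite -h interp_filter_rels mem_filter.
by case/andP.
Qed.

Lemma wf_interp A R t : wf A -> t \in interp A R ->
  0 < size t /\ all (fun x => x < univ A) t.
Proof.
case/andP=> _ /allP wfA /interpP [r rA [_ tr]].
have /andP [r0 /allP rt] := wfA r rA.
by have /andP [/eqP -> ->] := rt t tr.
Qed.

Lemma wf_symbol_inj A : wf A ->
  {in rels A &, injective (fun r : (S * nat) * seq (seq nat) => r.1.1)}.
Proof.
case/andP=> unq _ x y xA yA /= xy; move: unq; rewrite /symbols /vocab -map_comp => unq.
have := uniqP (x.1.1) unq.
move/(_ (index x (rels A)) (index y (rels A))); rewrite !inE size_map !index_mem xA yA.
rewrite !(nth_map x) ?index_mem // !nth_index // => /(_ isT isT xy) e.
by rewrite -(nth_index x xA) e nth_index.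
Qed.

Lemma vocab_arity A B R t s : wf A -> wf B -> perm_eq (vocab A) (vocab B) ->
  t \in interp A R -> s \in interp B R -> size t = size s.
Proof.
move=> wA wB pv /interpP [r rA [rR tr]] /interpP [r' r'B [r'R sr]].
have : r.1 \in vocab B by rewrite -(perm_mem pv); apply: map_f.
case/mapP => r'' r''B e; have e' : r'' = r'.
  by apply: (wf_symbol_inj wB); rewrite // -e rR r'R.
case/andP: wA => _ /allP wA; case/andP: wB => _ /allP wB.
have /andP [_ /allP /(_ t tr) /andP [/eqP -> _]] := wA r rA.
have /andP [_ /allP /(_ s sr) /andP [/eqP -> _]] := wB r' r'B.
by rewrite e e'.
Qed.

End FilterRels.

Lemma tsize_filter_rels (P : view_symbol -> seq nat -> bool) A :
  tsize (filter_rels P A) <= tsize A.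
Proof.
rewrite /enc /= ltnS leq_add2l; elim: (rels A) => //= r s IH.
rewrite ltnS; apply: leq_add => //; rewrite ltnS leq_add2l.
by elim: r.2 => //= t ts IHt; case: ifP => /= _; lia.
Qed.

Lemma iter_fix (T : Type) (f : T -> T) (mu : T -> nat) :
  (forall x, mu (f x) <= mu x) -> (forall x, mu x <= mu (f x) -> f x = x) ->
  forall n x, mu x <= n -> f (iter n f x) = iter n f x.
Proof.
move=> mu1 mu2; elim=> [|n IH] x mx; first by apply: mu2; move: mx; rewrite leqn0 => /eqP->.
case: (leqP (mu x) (mu (f x))) => [/mu2 fx|lt].
  have it k : iter k f x = x by elim: k => //= k ->.
  by rewrite it fx.
by rewrite iterSr; apply: IH; lia.
Qed.

Definition same_mem (p q : seq (nat * nat)) : bool :=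
  all (fun x => x \in q) p && all (fun x => x \in p) q.

Lemma same_memP p q : reflect (p =i q) (same_mem p q).
Proof.
apply: (iffP andP) => [[/allP pq /allP qp] x|pq].
  by apply/idP/idP => [/pq|/qp].
by split; apply/allP => x; rewrite pq.
Qed.

Definition common (t u : seq nat) : seq nat := [seq x <- t | x \in u].

Definition supported (AV BV : structure view_symbol) (V : view_symbol) (s : seq nat) : bool :=
  all (fun t => all (fun r => all (fun u =>
    nilp (common t u) ||
    has (fun s' => same_mem (proj (common t u) t s) (proj (common t u) u s'))
      (interp BV r.1.1)) r.2) (rels AV)) (interp AV V).

Lemma supportedP AV BV V s : reflect
  (forall t W u, t \in interp AV V -> u \in interp AV W -> common t u != [::] ->
     exists2 s', s' \in interp BV W & proj (common t u) t s =i proj (common t u) u s')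
  (supported AV BV V s).
Proof.
apply: (iffP allP) => [h t W u tV /interpP [r rA [<- ur]] X0|h t tV].
  have /allP /(_ r rA) /allP /(_ u ur) := h t tV.
  rewrite /nilp size_eq0 (negbTE X0) /= => /hasP [s' s'W /same_memP e].
  by exists s'.
apply/allP => r rA; apply/allP => u ur; apply/orP; rewrite /nilp size_eq0.
case: eqP => [|/eqP X0]; [by left|right].
have [|s' s'W e] := h t r.1.1 u tV _ X0; first by apply/interpP; exists r.
by apply/hasP; exists s' => //; apply/same_memP.
Qed.

Definition gac_step AV BV := filter_rels (supported AV BV) BV.

Definition gac_closure AV BV := iter (size (tuples BV)) (gac_step AV) BV.

Lemma substructure_refl B : substructure B B.
Proof. by split=> // V t. Qed.

Lemma substructure_trans B C D :
  substructure B C -> substructure C D -> substructure B D.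
Proof.
by case=> u1 v1 s1 [u2 v2 s2]; split=> [||V x /s1/s2]; rewrite // ?u1 ?v1.
Qed.

Lemma filter_rels_sub P B : substructure (filter_rels P B) B.
Proof.
split=> // [|V t]; first exact: vocab_filter_rels.
by rewrite interp_filter_rels mem_filter => /andP [].
Qed.

Lemma consistentP AV BV :
  consistent AV BV <-> forall V s, s \in interp BV V -> supported AV BV V s.
Proof.
split=> [h V s sV|h V W t u tV uW X X0 s sV].
  by apply/supportedP => t W u tV uW X0; apply: h X0 s sV.
by have /supportedP := h V s sV; apply.
Qed.

Lemma supported_mono AV B C V s : (forall W, {subset interp B W <= interp C W}) ->
  supported AV B V s -> supported AV C V s.
Proof.
move=> sub /supportedP h; apply/supportedP => t W u tV uW X0.
by have [s' /sub s'W e] := h t W u tV uW X0; exists s'.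
Qed.

Lemma iter_gac_step AV n B : exists P, iter n (gac_step AV) B = filter_rels P B.
Proof.
elim: n => [|n [P IH]] /=.
  exists (fun _ _ => true); case: B => n r; rewrite /filter_rels /=; congr Structure.
  by rewrite -[LHS]map_id; apply: eq_map => -[x y] /=; rewrite filter_predT.
rewrite {}IH; set Q := supported AV (filter_rels P B); exists (fun V t => Q V t && P V t).
rewrite /gac_step /filter_rels /= -/Q; congr Structure; rewrite -map_comp.
by apply: eq_map => -[x y] /=; rewrite filter_predI.
Qed.

Lemma gac_closure_filter AV B : exists P, gac_closure AV B = filter_rels P B.
Proof. exact: iter_gac_step. Qed.

Lemma gac_closureP AV BV : gac AV BV (gac_closure AV BV).
Proof.
split.
- by have [P ->] := gac_closure_filter AV BV; exact: filter_rels_sub.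
- apply/consistentP/filter_rels_all; rewrite -/(gac_step AV _).
  apply: (iter_fix (mu := fun B => size (tuples B))) => // B.
    exact: size_filter_rels.
  exact: filter_rels_fix.
- move=> C CB /consistentP cC; rewrite /gac_closure.
  elim: (size _) => //= n [u v s]; split=> [//||V t tV].
    by rewrite vocab_filter_rels.
  rewrite interp_filter_rels mem_filter s // andbT.
  by apply: supported_mono (cC _ _ tV) => W.
Qed.

Definition restrict_doms (xs a : seq nat) : structure view_symbol -> structure view_symbol :=
  filter_rels (fun V s => all (fun p => (V == dom_view p.1) ==> (s == [:: p.2])) (zip xs a)).

Definition propagate AV BV xs a := gac_closure AV (restrict_doms xs a BV).

Lemma dom_view_inj : injective dom_view.
Proof. by move=> x y []. Qed.

Lemma interp_set_rel (S : eqType) (B : structure S) R ts V :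
  interp (set_rel B R ts) V =i
  (if V == R then (if R \in symbols B then ts else [::]) else interp B V).
Proof.
move=> t; apply/interpP/idP.
  case=> r /mapP [r' r'B ->] [<-]; case: (r'.1.1 =P R) => [e|/eqP/negbTE ne] /=.
    rewrite e eqxx; suff -> : R \in symbols B by [].
    by rewrite mem_symbols; apply/hasP; exists r' => //; apply/eqP.
  by rewrite ne => tr; apply/interpP; exists r'.
case: eqP => [->|/eqP ne].
  rewrite mem_symbols; case: hasP => // -[r rB /eqP rR] tts.
  exists (r.1, ts) => //; apply/mapP; exists r => //.
  by rewrite rR eqxx.
case/interpP => r rB [rV tr]; exists r => //; apply/mapP; exists r => //.
by rewrite rV (negbTE ne).
Qed.

Lemma vocab_set_rel (S : eqType) (B : structure S) R ts : vocab (set_rel B R ts) = vocab B.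
Proof. by rewrite /vocab /= -map_comp; apply: eq_map => r /=; case: ifP. Qed.

(* The restrictions of the domains may be imposed all at once on the initial
   views instead of one after the other on propagated ones. *)
Lemma gac_propagate AV BV xs a v :
  uniq xs -> size a < size xs ->
  [:: v] \in interp (propagate AV BV xs a) (dom_view (nth 0 xs (size a))) ->
  gac AV (set_rel (propagate AV BV xs a) (dom_view (nth 0 xs (size a))) [:: [:: v]])
    (propagate AV BV xs (rcons a v)).
Proof.
set x := nth 0 xs (size a) => uxs lta vx.
set G := propagate AV BV xs a; set G' := propagate AV BV xs (rcons a v).
have zipE : zip xs (rcons a v) = rcons (zip xs a) (x, v).
  rewrite /x; elim: (a) (xs) lta => [|b a' IH] [|y ys] //=.
    by case: ys.
  by rewrite ltnS => /IH ->.
have [[uG vG sG] cG lG] := gac_closureP AV (restrict_doms xs a BV).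
have [[uG' vG' sG'] cG' lG'] := gac_closureP AV (restrict_doms xs (rcons a v) BV).
rewrite -/(propagate AV BV xs a) -/G in uG vG sG cG lG.
rewrite -/(propagate AV BV xs (rcons a v)) -/G' in uG' vG' sG' cG' lG'.
have xG : dom_view x \in symbols G by apply: interp_symbols vx.
have voc b : vocab (restrict_doms xs b BV) = vocab BV by exact: vocab_filter_rels.
have G'G : substructure G' G.
  apply: lG => //; split=> [||V t /sG']; rewrite ?uG' ?vG' ?voc //.
  rewrite /restrict_doms !interp_filter_rels !mem_filter zipE all_rcons.
  by case/andP => /andP [_ ->] ->.
split=> //.
  split=> [||V t tV]; first by rewrite uG' /= uG.
    by rewrite vocab_set_rel vG' vG !voc.
  rewrite interp_set_rel xG; case: eqP => [e|_]; last by case: G'G => _ _; apply.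
  move: tV => /sG'; rewrite interp_filter_rels mem_filter zipE all_rcons /= e eqxx /=.
  by rewrite inE; case/andP => /andP [].
move=> C [uC vC sC] cC; apply: lG' => //; split=> [||V t tV].
- by rewrite uC /= uG.
- by rewrite vC vocab_set_rel vG !voc.
move: (sC _ _ tV); rewrite interp_set_rel xG /restrict_doms !interp_filter_rels.
rewrite mem_filter zipE all_rcons /=.
have imp s W : s \in interp G W -> (s \in interp BV W) &&
    all (fun p => (W == dom_view p.1) ==> (s == [:: p.2])) (zip xs a).
  by move/sG; rewrite interp_filter_rels mem_filter andbC.
case: eqP => [->|_ /imp/andP [-> ->]] //=; rewrite inE => /eqP ->.
by rewrite eqxx /=; move: (imp _ _ vx) => /andP [-> ->].
Qed.

Lemma ptime_on2 E T U V `{encoding E, encoding T, encoding U, encoding V}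
    (f : E -> T) (g : E -> U) (h : T -> U -> V) :
  ptime (fun p : T * U => h p.1 p.2) -> ptime f -> ptime g ->
  ptime (fun e => h (f e) (g e)).
Proof. by move=> hh hf hg; exact: (ptime_on hh (ptime_pair hf hg)). Qed.

Lemma ptime_supported E `{encoding E} (A B : E -> structure view_symbol) V s :
  ptime A -> ptime B -> ptime V -> ptime s ->
  ptime (fun e => supported (A e) (B e) (V e) (s e)).
Proof.
move=> hA hB hV hs.
have h1 : ptime (fun p : (structure view_symbol * structure view_symbol) *
    (view_symbol * seq nat) => supported p.1.1 p.1.2 p.2.1 p.2.2).
  by rewrite /supported /common /same_mem /proj; ptime_auto.
exact: (ptime_on h1 (ptime_pair (ptime_pair hA hB) (ptime_pair hV hs))).
Qed.

Lemma ptime_gac_closure E `{encoding E} (f g : E -> structure view_symbol) :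
  ptime f -> ptime g -> ptime (fun e => gac_closure (f e) (g e)).
Proof.
move=> hf hg; apply: ptime_on2 hf hg.
apply: (ptime_iter (g := fun p => gac_step p.1) (l := fun p => tuples p.2)).
- rewrite /gac_step /filter_rels; ptime_auto.
  by apply: ptime_supported; ptime_auto.
- by move=> e y; exact: tsize_filter_rels.
- by ptime_auto.
- by rewrite /tuples; ptime_auto.
Qed.

Lemma ptime_propagate E `{encoding E} (f g : E -> structure view_symbol)
    (xs a : E -> seq nat) :
  ptime f -> ptime g -> ptime xs -> ptime a ->
  ptime (fun e => propagate (f e) (g e) (xs e) (a e)).
Proof.
move=> hf hg hxs ha; apply: ptime_gac_closure => //.
apply: (ptime_on2 (h := fun p => restrict_doms p.1 p.2) (f := fun e => (xs e, a e))) hg.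
  2: by ptime_auto.
by rewrite /restrict_doms /filter_rels; ptime_auto.
Qed.

Definition lookup (al : seq (nat * nat)) (x : nat) : nat :=
  head 0 [seq p.2 | p <- al & p.1 == x].

Lemma lookup_zip s t x : size s = size t -> lookup (zip s t) x = nth 0 t (index x s).
Proof.
elim: s t => [|y s IH] [|z t] //= [] /IH {}IH.
by rewrite /lookup /=; case: eqP => //= _; exact: IH.
Qed.

Definition column (A B : structure symbol) (x : nat) : seq nat :=
  let cands := flatten [seq [seq (r.1.1, t) | t <- r.2 & x \in t] | r <- rels A] in
  if nilp cands then iota 0 (univ B) else
  let c := head (Sym 0, [::]) cands in
  [seq lookup (zip c.2 s) x | s <- interp B c.1].

Definition default_choice (I : instance) : choice :=
  ([seq x <- iota 0 (univ (lhs I)) | x \notin outv I],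
   [seq column (lhs I) (rhs I) x | x <- iota 0 (univ (lhs I))]).

Lemma ptime_default_choice : ptime default_choice.
Proof.
have [h1 h2 h3] : [/\ ptime (fun I => lhs I), ptime (fun I => rhs I)
  & ptime (fun I => outv I)].
  exact: ptime_instance (ptime_id _).
have : ptime (fun p : (structure symbol * structure symbol) * seq nat =>
    ([seq x <- iota 0 (univ p.1.1) | x \notin p.2],
     [seq column p.1.1 p.1.2 x | x <- iota 0 (univ p.1.1)])).
  rewrite /column /lookup; ptime_auto.
by move/(fun h => ptime_on h (ptime_pair (ptime_pair h1 h2) h3)).
Qed.

Lemma csp_vocab A B R : csp A B -> (R \in symbols A) = (R \in symbols B).
Proof. by case=> _ _ /(perm_map fst) /perm_mem ->. Qed.

Lemma choice_policy_default : choice_policy default_choice.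
Proof.
split; last first.
  have h : ptimeD ecsp (default_choice : instance -> seq nat * seq (seq nat)).
    exact: ptimeW ptime_default_choice.
  by case/polytime_ptime: h => P [p hP]; exists P, p.
move=> I [[[wA _] wB pv] uO /allP hO]; split.
  rewrite /=; apply: uniq_perm; rewrite ?iota_uniq //.
    rewrite cat_uniq uO filter_uniq ?iota_uniq // andbT /=.
    by apply/hasPn => x; rewrite mem_filter => /andP [].
  move=> x; rewrite mem_cat mem_filter mem_iota /=.
  by case: (boolP (x \in outv I)) => //= /hO ->.
move=> x xA _; rewrite /= (nth_map 0) ?size_iota // nth_iota // add0n /column.
set cands := flatten _.
have candsP c : c \in cands <-> c.2 \in interp (lhs I) c.1 /\ x \in c.2.
  split=> [/flattenP [s /mapP [r rA ->] /mapP [t]]|[/interpP [r rA [rR cr]] xc]].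
    rewrite mem_filter => /andP [xt tr] -> /=; split=> //.
    by apply/interpP; exists r.
  apply/flattenP; eexists; first by apply: map_f rA.
  by apply/mapP; exists c.2; rewrite ?mem_filter ?xc // rR -surjective_pairing.
case: (cands) candsP => [|c cs] candsP /=; [right|left].
  by split=> // R t tR; apply/negP => xt; have := (candsP (R, t)).2 (conj tR xt).
have [cI xc] := (candsP c).1 (mem_head _ _).
exists c.1, c.2, (index x c.2); rewrite index_mem nth_index //; split=> // y.
suff -> : [seq lookup (zip c.2 s) x | s <- interp (rhs I) c.1] =
  [seq nth 0 s (index x c.2) | s <- interp (rhs I) c.1] by [].
by apply/eq_in_map => s sI; apply: lookup_zip (vocab_arity wA wB pv cI sI).
Qed.

Definition certifies (I : instance) (h : seq nat) (c : seq (nat * nat)) : bool :=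
  let al := zip (outv I) h ++ c in
  [&& h == [seq lookup al x | x <- outv I],
      all (fun x => lookup al x < univ (rhs I)) (iota 0 (univ (lhs I)))
    & all (fun r => all (fun t => [seq lookup al x | x <- t] \in interp (rhs I) r.1.1) r.2)
        (rels (lhs I))].

Lemma certifies_sound I h c :
  certifies I h c -> hom_restr (lhs I) (rhs I) (outv I) h.
Proof.
case/and3P => /eqP hE /allP hu /allP hr.
exists (lookup (zip (outv I) h ++ c)) => //; split=> [x xA|R t].
  by apply: hu; rewrite mem_iota.
by case/interpP => r /hr /allP ht [<- /ht].
Qed.

Lemma certifies_complete I ys a (f : nat -> nat) :
  perm_eq (outv I ++ ys) (iota 0 (univ (lhs I))) -> wf (lhs I) ->
  a = map f (outv I ++ ys) -> Defs.hom (lhs I) (rhs I) f ->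
  certifies I (take (size (outv I)) a) (zip ys (drop (size (outv I)) a)).
Proof.
move=> pI wA -> [hu hr].
rewrite map_cat take_size_cat ?size_map // drop_size_cat ?size_map // /certifies.
rewrite -zip_cat ?size_map // -map_cat.
have lE x : x < univ (lhs I) -> lookup (zip (outv I ++ ys) (map f (outv I ++ ys))) x = f x.
  move=> xA; have xI : x \in outv I ++ ys by rewrite (perm_mem pI) mem_iota.
  by rewrite lookup_zip ?size_map // (nth_map 0) ?index_mem // nth_index.
apply/and3P; split.
- apply/eqP/esym/eq_in_map => x xO; apply: lE.
  have : x \in outv I ++ ys by rewrite mem_cat xO.
  by rewrite (perm_mem pI) mem_iota.
- by apply/allP => x; rewrite mem_iota => xA; rewrite lE // hu.
apply/allP => r rA; apply/allP => t tr.
have tI : t \in interp (lhs I) r.1.1 by apply/interpP; exists r.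
have [_ /allP tA] := wf_interp wA tI.
suff -> : [seq lookup (zip (outv I ++ ys) [seq f i | i <- outv I ++ ys]) x | x <- t] =
  map f t by exact: hr.
by apply/eq_in_map => x /tA; exact: lE.
Qed.

Lemma ptime_certifies :
  ptime (fun p : instance * (seq nat * seq (nat * nat)) => certifies p.1 p.2.1 p.2.2).
Proof.
have [h1 h2 h3] : [/\ ptime (fun I => lhs I), ptime (fun I => rhs I)
  & ptime (fun I => outv I)].
  exact: ptime_instance (ptime_id _).
have h : ptime (fun p : ((structure symbol * structure symbol) * seq nat) *
    (seq nat * seq (nat * nat)) =>
  let al := zip p.1.2 p.2.1 ++ p.2.2 in
  [&& p.2.1 == [seq lookup al x | x <- p.1.2],
      all (fun x => lookup al x < univ p.1.1.2) (iota 0 (univ p.1.1.1))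
    & all (fun r => all (fun t => [seq lookup al x | x <- t] \in interp p.1.1.2 r.1.1) r.2)
        (rels p.1.1.1)]).
  by rewrite /lookup; cbv zeta; ptime_auto.
have i1 := ptime_id (E := instance * (seq nat * seq (nat * nat))) (fun=> True).
apply: (ptime_on h (f := fun p : instance * (seq nat * seq (nat * nat)) =>
  ((lhs p.1, rhs p.1, outv p.1), p.2))).
apply: ptime_pair; last by ptime_auto.
by do 2?apply: ptime_pair; [apply: (ptime_on h1)|apply: (ptime_on h2)|apply: (ptime_on h3)]; ptime_auto.
Qed.

(** * The search as a loop on a stack of partial assignments *)

Definition context := ((structure view_symbol * structure view_symbol) * (seq nat * nat))%type.

Section Search.
Variables (AV BV : structure view_symbol) (xs : seq nat) (m : nat).

Definition leaf_output (a : seq nat) : seq nat * seq (nat * nat) :=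
  (take m a, zip (drop m xs) (drop m a)).

Definition values (a : seq nat) : seq nat :=
  [seq v <- iota 0 (univ BV) |
    [:: v] \in interp (propagate AV BV xs a) (dom_view (nth 0 xs (size a)))].

Definition active (a : seq nat) : seq nat :=
  if m < (size a).+1 then take 1 (values a) else values a.

Definition fails (a : seq nat) : bool :=
  (0 < size a) && is_empty (propagate AV BV xs a).

Definition children (a : seq nat) : seq (seq nat) := [seq rcons a v | v <- active a].

Definition next (a : seq nat) (stk : seq (seq nat)) : option tree * seq (seq nat) :=
  if size a == size xs then (Some (enc_output (Some (leaf_output a))), stk)
  else if fails a then (Some (enc_output None), [::])
  else (None, children a ++ stk).

Fixpoint search_all (f : seq nat -> seq output * bool) (s : seq (seq nat)) :
    seq output * bool :=
  if s is a :: s' then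
    if (f a).2 then ((f a).1, true)
    else ((f a).1 ++ (search_all f s').1, (search_all f s').2)
  else ([::], false).

Fixpoint search (k : nat) (a : seq nat) : seq output * bool :=
  if k is k'.+1 then
    if fails a then ([:: None], true) else search_all (search k') (children a)
  else ([:: Some (leaf_output a)], false).

Hypothesis uxs : uniq xs.
Hypothesis wfBV : wf BV.
Hypothesis domBV : forall x t, x \in xs -> t \in interp BV (dom_view x) -> size t = 1.

Lemma propagate_sub a V t :
  t \in interp (propagate AV BV xs a) V -> t \in interp BV V.
Proof.
have [[_ _ s] _ _] := gac_closureP AV (restrict_doms xs a BV).
by move/s; rewrite interp_filter_rels mem_filter => /andP [].
Qed.

Lemma values_interp a : size a < size xs ->
  [seq [:: v] | v <- values a] =i
  interp (propagate AV BV xs a) (dom_view (nth 0 xs (size a))).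
Proof.
move=> lta t; apply/mapP/idP => [[v]|tI].
  by rewrite mem_filter => /andP [vI _] ->.
have tB := propagate_sub tI; have [_ /allP tU] := wf_interp wfBV tB.
have := domBV (mem_nth 0 lta) tB.
case: t tI tB tU => [|v [|]] // tI tB tU _; exists v => //.
by rewrite mem_filter tI mem_iota tU ?inE.
Qed.

Lemma cploop_search_all ys x xs' B a f vs :
  (forall v, v \in vs ->
     cpbody AV m ys x xs' B a v (f (rcons a v)).1 (f (rcons a v)).2) ->
  let s := search_all f [seq rcons a v | v <- if m < (size a).+1 then take 1 vs else vs] in
  cploop AV m ys x xs' B a vs s.1 s.2.
Proof.
elim: vs => [|v vs IH] hv; first by case: ifP => _; constructor.
have := hv v (mem_head _ _).
case: ltnP IH => [ltm|lem] IH /=; rewrite ?take0 /=; case: (f _) => o [] /= bv.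
- exact: cpl_halt.
- by rewrite cats0; apply: cpl_break.
- exact: cpl_halt.
apply: cpl_next => //; apply: IH => w wvs; apply: hv.
by rewrite inE wvs orbT.
Qed.

Lemma search_cpropagate k a BVa : size a + k.+1 = size xs ->
  gac AV BVa (propagate AV BV xs a) ->
  cpropagate AV m (drop m xs) (drop (size a) xs) BVa a (search k.+1 a).1 (search k.+1 a).2.
Proof.
elim: k a BVa => [|k IH] a BVa sa ga;
  have lta : size a < size xs by lia.
all: rewrite (drop_nth 0 lta) [search _.+1 _]/=.
all: case: ifPn => [/andP [a0 e0]|nf]; first exact: cp_failure ga a0 e0.
all: apply: (cp_search (vs := values a)) ga nf _ (values_interp lta) _;
  first by rewrite filter_uniq // iota_uniq.
all: apply: cploop_search_all => v.
  move=> _; rewrite (@drop_oversize _ (size a).+1); first exact: cpb_output.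
  by rewrite -sa addn1.
rewrite mem_filter => /andP [vI _].
have sz : size (rcons a v) + k.+1 = size xs by rewrite size_rcons; lia.
have := IH (rcons a v) _ sz (gac_propagate uxs lta vI).
rewrite size_rcons (@drop_nth _ 0 (size a).+1); last by lia.
by move=> h; apply: cpb_call.
Qed.

End Search.

Lemma ptime_next E `{encoding E} (c : E -> context) a stk :
  ptime c -> ptime a -> ptime stk ->
  ptime (fun e => next (c e).1.1 (c e).1.2 (c e).2.1 (c e).2.2 (a e) (stk e)).
Proof.
move=> hc ha hs.
have h : ptime (fun p : context * (seq nat * seq (seq nat)) =>
    next p.1.1.1 p.1.1.2 p.1.2.1 p.1.2.2 p.2.1 p.2.2).
  rewrite /next /children /active /fails /values /is_empty; ptime_auto.
  - apply: (ptime_eq (f := fun p : context * (seq nat * seq (seq nat)) =>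
      leaf_output p.1.2.1 p.1.2.2 p.2.1)) => //.
    by rewrite /leaf_output; ptime_auto.
  - by apply: ptime_propagate; ptime_auto.
  - by apply: ptime_propagate; ptime_auto.
  - by apply: ptime_propagate; ptime_auto.
exact: (ptime_on h (ptime_pair hc (ptime_pair ha hs))).
Qed.

(* c is the time elapsed since the last emission when the log l begins. *)
Fixpoint delay_le (d c : nat) (l : log) : bool :=
  match l with
  | [::] => c <= d
  | None :: l' => delay_le d c.+1 l'
  | Some _ :: l' => (c <= d) && delay_le d 0 l'
  end.

Lemma delay_le_tick d c k l : delay_le d c (tick k ++ l) = delay_le d (c + k) l.
Proof. by elim: k c => [|k IH] c; rewrite ?addn0 //= IH addSnnS. Qed.

Lemma delay_le_start d c l : delay_le d c l -> c <= d.
Proof.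
elim: l c => [|[x|] l IH] c //=; first by case/andP.
by move/IH/ltnW.
Qed.

Lemma delay_le_infix d c l1 k l2 : delay_le d c (l1 ++ tick k ++ l2) -> k <= d.
Proof.
elim: l1 c => [|[x|] l1 IH] c /=.
- by rewrite delay_le_tick => /delay_le_start; apply: leq_trans; apply: leq_addl.
- by case/andP => _ /IH.
- by move/IH.
Qed.

Lemma pmap_tick k l : pmap id (tick k ++ l) = pmap id l :> seq tree.
Proof. by elim: k => //= k ->. Qed.

Definition stack := seq (seq nat).

Definition PEmit : prog := PPair (PIf PFst (PComp (PComp PFst PSnd) POut) PFst) PSnd.

Definition emission (o : option tree) (l : log) (b : nat) : Prop :=
  if o is Some t then
    exists k1 k2, [/\ l = tick k1 ++ Some t :: tick k2, k1 <= b & k2 <= b]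
  else exists2 k, l = tick k & k <= b.

Lemma emission_le o l b b' : b <= b' -> emission o l b -> emission o l b'.
Proof.
case: o => [t|] bb' /= => [[k1 [k2 [-> h1 h2]]]|[k -> h]].
  by exists k1, k2; rewrite (leq_trans h1) ?(leq_trans h2).
by exists k; rewrite ?(leq_trans h).
Qed.

Lemma emission_tick o l b k : emission o l b -> emission o (tick k ++ l) (k + b).
Proof.
case: o => [t|] /= => [[k1 [k2 [-> h1 h2]]]|[j -> h]].
  by exists (k + k1), k2; rewrite tickD catA; split=> //; lia.
by exists (k + j); [rewrite tickD | lia].
Qed.

Lemma emit_eval (o : option tree) (s : tree) : exists2 l,
  eval (PComp PEmit PSnd) (Node (enc o) s) s l &
  emission o l (11 * tree_size (Node (enc o) s)).
Proof.
case: o => [t|]; set z := Node _ s.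
  eexists.
    apply: ev_comp; last by constructor.
    apply: ev_pair; last by constructor.
    apply: ev_if_true; first by constructor.
    apply: ev_comp; last by constructor.
    by apply: ev_comp; constructor.
  pose tt := Node t s; pose zt := Node Leaf t.
  exists (tree_size z + (tree_size z + (tree_size z + (tree_size z +
    (tree_size zt + tree_size t))))).
  exists (tree_size z + (tree_size tt + tree_size tt)).
  have : tree_size tt <= tree_size z by rewrite /tt /z /=; lia.
  have : tree_size zt + tree_size t <= 2 * tree_size z by rewrite /zt /z /enc /=; lia.
  split; [by rewrite !tickD -cats1 -!catA | lia | lia].
eexists.
  apply: ev_comp; last by constructor.
  apply: ev_pair; last by constructor.
  by apply: ev_if_false; constructor.
exists (tree_size z + ((tree_size z + (tree_size z + tree_size z)) + (tree_size z +
  tree_size z)) + tree_size z); last by lia.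
by rewrite !tickD -!catA.
Qed.

Definition machine_step (e : context * stack) : option tree * (context * stack) :=
  let c := e.1 in
  let r := next c.1.1 c.1.2 c.2.1 c.2.2 (head [::] e.2) (behead e.2) in (r.1, (c, r.2)).

Lemma ptime_machine_step : ptime machine_step.
Proof.
have h : ptime (fun e : context * stack =>
    next e.1.1.1 e.1.1.2 e.1.2.1 e.1.2.2 (head [::] e.2) (behead e.2)).
  apply: ptime_next; ptime_auto.
  by apply: ptime_behead; ptime_auto.
apply: ptime_pair; first exact: ptime_fst h.
apply: ptime_pair; last exact: ptime_snd h.
by ptime_auto.
Qed.

Lemma tsize_cons T `{encoding T} (x : T) s :
  tsize (x :: s) = (tsize x + tsize s).+1.
Proof. by []. Qed.

Lemma tsize_pair T U `{encoding T, encoding U} (x : T) (y : U) :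
  tsize (x, y) = (tsize x + tsize y).+1.
Proof. by []. Qed.

Lemma tsize_all T `{encoding T} (p : pred T) (b : nat) (s : seq T) :
  (forall x, p x -> tsize x <= b) -> all p s -> tsize s <= (size s * b.+1).+1.
Proof.
move=> pb; elim: s => // x s IH /andP [/pb xb /IH sb].
by rewrite tsize_cons [size _]/= mulSn; lia.
Qed.

Section Loop.
Variables (N : prog) (bN : nat -> nat).
Hypothesis pbN : polynomial bN.
Hypothesis hN : forall e : context * stack, exists2 k,
  eval N (enc e) (enc (machine_step e)) (tick k) & k <= bN (tsize e).

Definition loop : prog := PWhile PSnd (PComp N (PComp PEmit PSnd)).

Variables (AV BV : structure view_symbol) (xs : seq nat) (m : nat).
Let c : context := ((AV, BV), (xs, m)).
Let n := size xs.

Definition stack_bound : nat :=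
  (n.+1 * (univ BV).+1 * (n * ((univ BV).*2.+2)).+2).+1.

Let T := 2 * (tree_size (enc c) + stack_bound).+1 +
  12 * bN (tree_size (enc c) + stack_bound).+1.

(* All frames of one depth on the stack are siblings. *)
Definition stack_inv (stk : stack) : Prop :=
  [/\ pairwise (fun a b => size b <= size a) stk,
      all (fun a => (size a <= n) && all (fun v => v < univ BV) a) stk
    & forall d, count (fun a => size a == d) stk <= (univ BV).+1].

Lemma stack_inv_size stk : stack_inv stk -> size stk <= n.+1 * (univ BV).+1.
Proof.
case=> _ h cnt.
have -> : size stk = \sum_(d < n.+1) count (fun a => size a == d) stk.
  elim: stk h {cnt} => [|a s IH] /=; first by rewrite big1.
  case/andP => /andP [an _] /IH ->; rewrite big_split /=.
  have -> : \sum_(i < n.+1) (size a == i) = 1; last by rewrite add1n.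
  rewrite (bigD1 (inord (size a))) //= inordK // eqxx big1 // => i.
  by apply: contraNeq; rewrite eqb0 negbK => /eqP ->; rewrite inord_val.
rewrite -[n.+1 in leqRHS]card_ord -sum_nat_const.
by apply: leq_sum => d _; exact: cnt.
Qed.

Lemma stack_inv_tsize stk : stack_inv stk -> tsize stk <= stack_bound.
Proof.
move=> inv; have szs := stack_inv_size inv; case: inv => _ h _.
have hb : forall a, (size a <= n) && all (fun v => v < univ BV) a ->
    tsize a <= (n * ((univ BV).*2.+2)).+1.
  move=> a /andP [an hv].
  apply: leq_trans (tsize_all (b := (univ BV).*2.+1) _ hv) _.
    by move=> x; rewrite tsize_nat; lia.
  by rewrite ltnS leq_mul2r an orbT.
apply: leq_trans (tsize_all hb h) _.
by rewrite /stack_bound ltnS leq_mul2r szs orbT.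
Qed.

Lemma stack_inv_behead a stk : stack_inv (a :: stk) -> stack_inv stk.
Proof.
case=> /= /andP [_ h1] /andP [_ h2] h3; split=> // d.
by apply: leq_trans (h3 d); apply: leq_addl.
Qed.

Lemma stack_inv_children a stk : size a < n ->
  stack_inv (a :: stk) -> stack_inv (children AV BV xs m a ++ stk).
Proof.
move=> lta [/= /andP [ha h1] /andP [/andP [_ ua] h2] h3].
have hch b : b \in children AV BV xs m a ->
    size b = (size a).+1 /\ all (fun v => v < univ BV) b.
  case/mapP => v vA ->; rewrite size_rcons all_rcons ua andbT; split=> //.
  have : v \in values AV BV xs a by move: vA; rewrite /active; case: ifP => // _ /mem_take.
  by rewrite mem_filter mem_iota => /andP [].
have szch : size (children AV BV xs m a) <= univ BV.
  rewrite size_map /active; have : size (values AV BV xs a) <= univ BV.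
    by rewrite size_filter; apply: leq_trans (count_size _ _) _; rewrite size_iota.
  by case: ifP => // _; rewrite size_take_min; lia.
split.
- rewrite pairwise_cat h1 andbT; apply/andP; split.
    apply/allrelP => b d /hch [-> _] /(allP ha) /=; lia.
  apply/(pairwiseP [::]) => i j ii jj _.
  by rewrite !(proj1 (hch _ (mem_nth _ _))).
- rewrite all_cat h2 andbT; apply/allP => b /hch [-> ->].
  by rewrite lta.
move=> d; rewrite count_cat; have := h3 d; rewrite /=.
case: (ltnP (size a) d) => [lt|le] h.
  have -> : count (fun b => size b == d) stk = 0.
    apply/eqP; rewrite -leqn0 leqNgt -has_count; apply/hasPn => b /(allP ha) /=.
    by lia.
  rewrite addn0; apply: leq_trans (count_size _ _) _; lia.
have -> : count (fun b => size b == d) (children AV BV xs m a) = 0.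
  apply/eqP; rewrite -leqn0 leqNgt -has_count; apply/hasPn => b /hch [-> _] /=.
  by lia.
by apply: leq_trans h; apply: leq_addl.
Qed.

Definition run (stk : stack) (l : log) : Prop :=
  eval loop (enc (c, stk)) (enc (c, [::] : stack)) l.

Lemma tsize_state stk : stack_inv stk -> tsize (c, stk) <= (tsize c + stack_bound).+1.
Proof. by move/stack_inv_tsize => h; rewrite [X in X <= _]/= ltnS leq_add2l. Qed.

Lemma run_nil : exists2 k, run [::] (tick k) & k <= T.
Proof.
exists (tsize (c, [::] : stack) + tsize (c, [::] : stack)).
  by rewrite /run tickD; apply: ev_while_stop; constructor.
have inv : stack_inv [::] by split.
by have := tsize_state inv; rewrite /T /=; lia.
Qed.

Lemma run_cons a stk l : stack_inv (a :: stk) ->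
  run (next AV BV xs m a stk).2 l ->
  exists2 l0, run (a :: stk) (l0 ++ l) & emission (next AV BV xs m a stk).1 l0 T.
Proof.
move=> inv hl; have [k ek lk] := hN (c, a :: stk).
have [l1 e1 em1] := emit_eval (next AV BV xs m a stk).1 (enc (c, (next AV BV xs m a stk).2)).
have sz := tsize_state inv.
have lkb : k <= bN (tsize c + stack_bound).+1.
  by apply: leq_trans lk _; apply: polynomial_mono.
have szn : tree_size (Node (enc (next AV BV xs m a stk).1)
    (enc (c, (next AV BV xs m a stk).2))) <= k.
  by have [_] := eval_size ek; rewrite size_tick.
have [st stE] : exists st, st = tsize (c, a :: stk) by eexists.
have es : run (a :: stk) (tick (st + (st + k)) ++ l1 ++ l).
  rewrite !tickD -!catA stE.
  have := ev_while_step (ev_snd _ _) (ev_comp ek e1) hl.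
  by rewrite -!catA; apply.
exists (tick (st + (st + k)) ++ l1); first by rewrite -catA.
have em2 := emission_le (leq_mul (leqnn 11) szn) em1.
apply: emission_le (emission_tick _ em2).
have hst : st <= (tree_size (enc c) + stack_bound).+1 by rewrite stE.
by move: hst lkb; rewrite /T; lia.
Qed.

Hypothesis progress : forall a, 0 < size a < n -> ~~ fails AV BV xs a ->
  active AV BV xs m a != [::].

Let d := T * n.+3.

Let search_ := search AV BV xs m.

(* l' is the log of the run on the stack below the frames whose search is res. Steps
   that emit nothing increase the depth of the top frame, hence a frame of depth j
   is entered at most (j + 1) T time units after the last emission. *)
Definition completes (stk : stack) (res : seq output * bool) (l' : log) (j : nat) : Prop :=
  exists l, [/\ run stk l,
    pmap id l = map enc_output res.1 ++ (if res.2 then [::] else pmap id l')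
    & forall t, t <= T * j.+1 -> delay_le d t l].

Lemma run_frames k :
  (forall a rest l', size a + k = n -> 0 < size a -> stack_inv (a :: rest) ->
     run rest l' -> (forall t, t <= T -> delay_le d t l') ->
     completes (a :: rest) (search_ k a) l' (size a)) ->
  forall j fs rest l', j + k = n -> 0 < j -> fs != [::] -> all (fun a => size a == j) fs ->
     stack_inv (fs ++ rest) -> run rest l' -> (forall t, t <= T -> delay_le d t l') ->
     completes (fs ++ rest) (search_all (search_ k) fs) l' j.
Proof.
move=> hk j fs rest l' jk j0; elim: fs => // a [|b fs] IH _ /andP [/eqP sa hfs] inv hl' dl'.
  have [||l [rl pl tl]] := hk a rest l' _ _ inv hl' dl'; rewrite ?sa //.
  exists l; split=> //; last by rewrite -sa.
  by rewrite /= pl; case: (search_ k a) => o [] /=; rewrite ?cats0.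
have [|l1 [rl1 pl1 tl1]] := IH _ hfs (stack_inv_behead inv) hl' dl' => //.
have dl1 t : t <= T -> delay_le d t l1.
  by move=> tT; apply: tl1; apply: leq_trans tT _; exact: leq_pmulr.
have [||l [rl pl tl]] := hk a _ l1 _ _ inv rl1 dl1; rewrite ?sa //.
exists l; split=> //; last by rewrite -sa.
rewrite pl [search_all _ (a :: _)]/= pl1.
by case: (search_ k a) => o [] /=; rewrite // map_cat catA.
Qed.

Lemma run_frame k a rest l' : size a + k = n -> 0 < size a -> stack_inv (a :: rest) ->
  run rest l' -> (forall t, t <= T -> delay_le d t l') ->
  completes (a :: rest) (search_ k a) l' (size a).
Proof.
have TT : T + T <= d by rewrite /d addnn -mul2n mulnC leq_mul2l; lia.
elim: k a rest l' => [|k IH] a rest l' sk a0 inv hl' dl'.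
  have nE : next AV BV xs m a rest =
      (Some (enc_output (Some (leaf_output xs m a))), rest).
    by rewrite /next -/n -sk addn0 eqxx.
  have [|l0 rl] := run_cons inv (l := l'); rewrite nE //.
  case=> k1 [k2 [l0E h1 h2]]; exists (l0 ++ l'); split=> //.
    by rewrite l0E -catA pmap_tick /= pmap_tick.
  move=> t ht; rewrite l0E -catA delay_le_tick /= delay_le_tick add0n dl' // andbT.
  rewrite /d; apply: leq_trans (leq_add ht h1) _.
  by rewrite -mulnSr leq_mul2l; lia.
case: (boolP (fails AV BV xs a)) => [fa|nfa].
  have nE : next AV BV xs m a rest = (Some (enc_output None), [::]).
    by rewrite /next fa; case: eqP => //; lia.
  have [j hj jT] := run_nil.
  have [|l0 rl] := run_cons inv (l := tick j); rewrite nE //.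
  case=> k1 [k2 [l0E h1 h2]]; exists (l0 ++ tick j); split=> //.
    rewrite l0E -catA pmap_tick /= -tickD -[tick _]cats0 pmap_tick.
    by rewrite /search_ /= fa.
  move=> t ht; rewrite l0E -catA delay_le_tick /= -tickD -[tick _]cats0 delay_le_tick /= add0n.
  apply/andP; split; last by lia.
  rewrite /d; apply: leq_trans (leq_add ht h1) _.
  by rewrite -mulnSr leq_mul2l; lia.
have lta : size a < n by lia.
have nE : next AV BV xs m a rest = (None, children AV BV xs m a ++ rest).
  by rewrite /next (negbTE nfa); case: eqP => //; lia.
have [|||||l [rl pl tl]] := run_frames IH (j := (size a).+1) (fs := children AV BV xs m a)
    (rest := rest) (l' := l') _ _ _ _ _ hl' dl'; try by lia.
- by rewrite -size_eq0 size_map size_eq0 progress ?a0.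
- by apply/allP => b /mapP [v _ ->]; rewrite size_rcons.
- exact: stack_inv_children.
have [|l0 rl0] := run_cons inv (l := l); rewrite nE // => -[k0 l0E h0].
exists (l0 ++ l); split=> //.
  by rewrite l0E pmap_tick pl /search_ /= (negbTE nfa).
move=> t ht; rewrite l0E delay_le_tick; apply: tl.
by rewrite mulnSr; apply: leq_add.
Qed.

Lemma run_root : 0 < n -> exists l,
  [/\ run [:: [::]] l, pmap id l = map enc_output (search_ n [::]).1
    & forall t, t <= T -> delay_le d t l].
Proof.
move=> n0; have inv : stack_inv [:: [::]].
  by split=> // j /=; case: (0 == j).
have nE : next AV BV xs m [::] [::] = (None, children AV BV xs m [::] ++ [::]).
  by rewrite /next /fails /=; case: eqP => //=; rewrite -/n; lia.
have [j hj jT] := run_nil.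
have dj t : t <= T -> delay_le d t (tick j).
  move=> tT; rewrite -[tick j]cats0 delay_le_tick /= /d; apply: leq_trans (leq_add tT jT) _.
  by rewrite addnn -mul2n mulnC leq_mul2l; lia.
have sE : search_ n [::] = search_all (search_ n.-1) (children AV BV xs m [::]).
  by rewrite /search_ -[in LHS](prednK n0).
have [ch0|chn] := eqVneq (children AV BV xs m [::]) [::].
  have [|l0 rl] := run_cons inv (l := tick j); rewrite nE ?ch0 //.
  case=> k0 l0E h0; exists (l0 ++ tick j); split=> //.
    by rewrite sE ch0 l0E pmap_tick -[tick j]cats0 pmap_tick.
  move=> t tT; rewrite l0E -tickD -[tick _]cats0 delay_le_tick /=.
  apply: leq_trans (leq_add tT (leq_add h0 jT)) _.
  by rewrite addnn -mul2n -mulSn /d mulnC leq_mul2l; lia.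
have [||||l [rl pl tl]] := run_frames (@run_frame n.-1) (j := 1) (fs := children AV BV xs m [::])
    (rest := [::]) (l' := tick j) _ _ chn _ _ hj dj => //; try by lia.
- by apply/allP => b /mapP [v _ ->].
- by apply: stack_inv_children.
have [|l0 rl0] := run_cons inv (l := l); rewrite nE // => -[k0 l0E h0].
exists (l0 ++ l); split=> //.
  rewrite l0E pmap_tick pl sE -[X in pmap id X](cats0 (tick j)) pmap_tick /=.
  by case: ifP; rewrite cats0.
move=> t tT; rewrite l0E delay_le_tick; apply: tl.
by rewrite muln2 -addnn leq_add.
Qed.

End Loop.

(** * Join trees *)

Section JoinTree.
Variables (n : nat) (H : {set {set 'I_n}}) (E : rel {set 'I_n}).
Hypothesis jt : join_tree H E.

Definition subtree (S : {set {set 'I_n}}) : Prop :=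
  S \subset H /\
  forall u v, u \in S -> v \in S -> exists2 p, simple_path H E u v p & all (mem S) p.

Lemma simple_pathP u v p :
  reflect [/\ path E u p, last u p = v, uniq (u :: p) & all (mem H) (u :: p)]
    (simple_path H E u v p).
Proof. by apply: (iffP and4P) => -[h1 /eqP h2 h3 h4]; split=> //; apply/eqP. Qed.

Lemma subtree1 u : u \in H -> subtree [set u].
Proof.
move=> uH; split; first by rewrite sub1set.
move=> _ _ /set1P -> /set1P ->; exists [::] => //.
by apply/simple_pathP; rewrite /= uH.
Qed.

Lemma subtree_grow S : subtree S -> S != set0 -> S != H ->
  exists p g, [/\ p \in S, g \in H :\: S, subtree (g |: S)
    & forall e y, e \in S -> y \in e -> y \in g -> y \in p].
Proof.
case: jt => -[Esym Euniq] Ejoin [/subsetP SH Sconn] /set0Pn [u uS] SnH.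
have [g0 g0H g0S] : exists2 g, g \in H & g \notin S.
  apply/subsetPn; apply: contra SnH => HS; rewrite eqEsubset HS andbT.
  exact/subsetP.
have [p [g [pS gH gS Epg]]] : exists p g, [/\ p \in S, g \in H, g \notin S & E p g].
  have [q [/simple_pathP [pq lq _ /andP [_ hq]] _]] := Euniq u g0 (SH u uS) g0H.
  elim: q u uS pq lq hq => [|w q IH] u uS /=; first by move=> _ e; rewrite -e uS in g0S.
  case/andP => Euw pq lq /andP [wH hq]; case: (boolP (w \in S)) => wS.
    exact: IH pq lq hq.
  by exists u, w.
have toG e : e \in S -> exists r,
    [/\ simple_path H E e g (rcons r g), last e r = p & all (mem S) r].
  move=> eS; have [r /simple_pathP [pr lr ur hr] rS] := Sconn e p eS pS.
  exists r; split=> //; apply/simple_pathP; split.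
  - by rewrite rcons_path pr lr.
  - by rewrite last_rcons.
  - rewrite -rcons_cons rcons_uniq ur andbT; apply: contra gS.
    by rewrite inE => /predU1P [->//|/(allP rS)].
  - by rewrite -rcons_cons all_rcons hr andbT.
exists p, g; split=> //; first by rewrite inE gS.
  split; first by apply/subsetP => e /setU1P [->//|/SH].
  have SgS r : all (mem S) r -> all (mem (g |: S)) r.
    by apply: sub_all => e /= eS; apply/setU1P; right.
  move=> e f /setU1P [->|eS] /setU1P [->|fS].
  - by exists [::] => //; apply/simple_pathP; rewrite /= gH.
  - have [r /simple_pathP [pr lr ur hr] rS] := Sconn p f pS fS.
    exists (p :: r); last by rewrite /= (SgS _ rS) andbT; apply/setU1P; right.
    apply/simple_pathP; split=> //.
    + by rewrite /= Esym Epg.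
    + rewrite cons_uniq ur andbT; apply: contra gS.
      by rewrite inE => /predU1P [->//|/(allP rS)].
    + by rewrite /= gH.
  - have [r [sr _ rS]] := toG e eS; exists (rcons r g) => //.
    by rewrite all_rcons (SgS _ rS) andbT; apply/setU1P; left.
  - have [r sr rS] := Sconn e f eS fS; exists r => //; exact: SgS.
move=> e y eS ye yg; have [r [sr lr rS]] := toG e eS.
have := Ejoin _ _ _ _ sr ye yg; rewrite all_rcons => /andP [_ hr].
by rewrite -lr; case/lastP: r hr {sr lr rS} => [|r w] //=; rewrite last_rcons all_rcons => /andP [].
Qed.

End JoinTree.

(** * Consistent views *)

Lemma zip_mem (t s : seq nat) y b : (y, b) \in zip t s -> y \in t /\ b \in s.
Proof.
elim: t s => [|x t IH] [|c s] //=; rewrite inE => /predU1P [[-> ->]|/IH [h1 h2]].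
  by rewrite !mem_head.
by rewrite !inE h1 h2 !orbT.
Qed.

Lemma zip_memP (t s : seq nat) y : size t = size s -> y \in t -> exists b, (y, b) \in zip t s.
Proof.
elim: t s => [|x t IH] [|c s] //= [] /IH {}IH; rewrite inE => /predU1P [->|/IH [b yb]].
  by exists c; rewrite mem_head.
by exists b; rewrite inE yb orbT.
Qed.

Lemma lookup_mem (t s : seq nat) y : size t = size s -> y \in t ->
  (y, lookup (zip t s) y) \in zip t s.
Proof.
move=> ts yt; have [b yb] := zip_memP ts yt; rewrite /lookup.
set l := [seq _ | _ <- _ & _]; have : head 0 l \in l.
  have : b \in l by apply/mapP; exists (y, b); rewrite // mem_filter eqxx.
  by case: (l) => // c r _; exact: mem_head.
by case/mapP => -[y' c]; rewrite mem_filter /= => /andP [/eqP -> yc] ->.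
Qed.

Lemma zip_map (t s : seq nat) f : size t = size s ->
  (forall y b, (y, b) \in zip t s -> b = f y) -> s = map f t.
Proof.
elim: t s => [|x t IH] [|c s] //= [] /IH {}IH h.
by rewrite -(h x c) ?mem_head // -IH // => y b yb; apply: h; rewrite inE yb orbT.
Qed.

Section Views.
Variables (A B : structure symbol) (AV BV : structure view_symbol).
Hypothesis cAB : csp A B.
Hypothesis vAV : view_structure A AV.
Hypothesis lBV : legal A B AV BV.
Hypothesis domA : forall x, x < univ A -> [:: x] \in interp A (Dom x).

Lemma AV_tuple V t : t \in interp AV V -> 0 < size t /\ {in t, forall y, y < univ A}.
Proof.
case: vAV => wAV uAV _ _ tV; have [t0 /allP tU] := wf_interp wAV tV.
by split=> // y /tU; rewrite uAV.
Qed.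

Lemma AV_dom x t : x < univ A -> (t \in interp AV (dom_view x)) = (t == [:: x]).
Proof.
move=> xA; case: vAV => _ _ _ /(_ _ _ (domA xA)) h.
by rewrite /dom_view h inE.
Qed.

Lemma AV_base R t u : t \in interp A R -> (u \in interp AV (Base R t)) = (u == t).
Proof. by move=> tR; case: vAV => _ _ _ /(_ _ _ tR) h; rewrite h inE. Qed.

Section Consistent.
Variable C : structure view_symbol.
Hypothesis subC : substructure C BV.
Hypothesis conC : consistent AV C.

Lemma C_sub V s : s \in interp C V -> s \in interp BV V.
Proof. by case: subC => _ _; apply. Qed.

Lemma C_size V t s : t \in interp AV V -> s \in interp C V -> size t = size s.
Proof.
move=> tV /C_sub sV; case: vAV lBV => wAV _ _ _ [wBV pV _ _].
by apply: vocab_arity tV sV => //; rewrite perm_sym.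
Qed.

Lemma C_view V s : s \in interp C V -> exists t, t \in interp AV V.
Proof.
move=> /C_sub /interp_symbols; case: vAV lBV => _ _ hV _ [_ /(perm_map fst) /perm_mem pV _ _].
rewrite /symbols pV => /hV [t ht]; exists t; by rewrite ht mem_head.
Qed.

Lemma support V W t u s : t \in interp AV V -> u \in interp AV W -> s \in interp C V ->
  has (fun y => y \in u) t ->
  exists2 s', s' \in interp C W &
    forall y b, y \in t -> y \in u -> ((y, b) \in zip u s') = ((y, b) \in zip t s).
Proof.
move=> tV uW sV tu; have [|s' s'W e] := conC tV uW _ sV; first by rewrite -has_filter.
exists s' => // y b yt yu; have := e (y, b).
by rewrite /proj !mem_filter /= yt yu.
Qed.

Lemma C_dom x s : x < univ A -> s \in interp C (dom_view x) -> exists v, s = [:: v].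
Proof.
move=> xA sx; have := C_size (t := [:: x]) _ sx; rewrite AV_dom // eqxx => /(_ isT).
by case: s {sx} => [|v [|]] // _; exists v.
Qed.

Lemma to_dom V t s x : t \in interp AV V -> s \in interp C V -> x \in t ->
  exists2 v, [:: v] \in interp C (dom_view x) & forall b, ((x, b) \in zip t s) = (b == v).
Proof.
move=> tV sV xt; have [_ tA] := AV_tuple tV; have xA := tA x xt.
have [||s' s'x e] := support (u := [:: x]) (W := dom_view x) tV _ sV.
- by rewrite AV_dom.
- by apply/hasP; exists x; rewrite ?mem_head.
have [v s'E] := C_dom xA s'x; subst s'; exists v => // b.
by rewrite -e ?mem_head //= inE xpair_eqE eqxx.
Qed.

Lemma C_functional V t s x b b' : t \in interp AV V -> s \in interp C V ->
  (x, b) \in zip t s -> (x, b') \in zip t s -> b = b'.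
Proof.
move=> tV sV h h'; have [xt _] := zip_mem h.
have [v _ e] := to_dom tV sV xt.
by move: h h'; rewrite !e => /eqP -> /eqP ->.
Qed.

Lemma C_map V t s f : t \in interp AV V -> s \in interp C V ->
  (forall y, y \in t -> (y, f y) \in zip t s) -> s = map f t.
Proof.
move=> tV sV h; apply: zip_map => [|y b yb]; first exact: C_size tV sV.
have [yt _] := zip_mem yb.
exact: C_functional tV sV yb (h y yt).
Qed.

Lemma C_dom_univ x v : x < univ A -> [:: v] \in interp C (dom_view x) -> v < univ B.
Proof.
move=> xA /C_sub vx; case: lBV => _ _ _ /(_ _ _ (domA xA)) /(_ _ vx) vB.
case: cAB => _ wB _; have [_ /andP []] := wf_interp wB vB.
by [].
Qed.

Lemma C_base R t s : t \in interp A R -> s \in interp C (Base R t) -> s \in interp B R.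
Proof. by move=> tR /C_sub; case: lBV => _ _ _ /(_ _ _ tR); apply. Qed.

Hypothesis conA : connected A.

Lemma C_nonempty V0 s0 V t : s0 \in interp C V0 -> t \in interp AV V ->
  exists s, s \in interp C V.
Proof.
pose ne (x : nat) := exists v, [:: v] \in interp C (dom_view x).
have toV x W u : ne x -> u \in interp AV W -> x \in u -> exists s, s \in interp C W.
  move=> [v vx] uW xu; have [_ uA] := AV_tuple uW; have xA := uA x xu.
  have [||s sW _] := support (t := [:: x]) _ uW vx; last by exists s.
    by rewrite AV_dom.
  by rewrite /= xu.
have ofV x W u s : s \in interp C W -> u \in interp AV W -> x \in u -> ne x.
  by move=> sW uW xu; have [v vx _] := to_dom uW sW xu; exists v.
move=> s0V tV; have [t0 t0V] := C_view s0V.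
have [x xt0] : exists x, x \in t0.
  by case: (AV_tuple t0V); case: (t0) => // x r _ _; exists x; rewrite mem_head.
have [y yt] : exists y, y \in t.
  by case: (AV_tuple tV); case: (t) => // y r _ _; exists y; rewrite mem_head.
have xA := (AV_tuple t0V).2 x xt0; have yA := (AV_tuple tV).2 y yt.
have nex : ne (Ordinal xA) by exact: ofV s0V t0V xt0.
suff ney : ne (Ordinal yA) by exact: toV ney tV yt.
have /andP [_ /forallP /(_ (Ordinal xA)) /forallP /(_ (Ordinal yA)) /connectP [p pp ->]] := conA.
elim: p (Ordinal xA) nex pp => //= z p IH w new /andP [/existsP [e /andP [eA /andP [we ze]]] pp].
apply: IH pp; move: eA we ze; rewrite inE => /mapP [u /tuplesP [R uR] ->]; rewrite !inE => wu zu.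
have uB : u \in interp AV (Base R u) by rewrite AV_base.
have [s sR] := toV _ _ _ new uB wu.
exact: ofV sR uB zu.
Qed.

Section TreeProjection.
Let n := univ A.
Variable Ha : {set {set 'I_n}}.
Hypothesis acyHa : acyclic Ha.
Hypothesis leA : hle (hypergraph_of n A) Ha.
Hypothesis leV : hle Ha (hypergraph_of n AV).

Definition satisfied (f : nat -> nat) (e : {set 'I_n}) : Prop :=
  exists V t s, [/\ t \in interp AV V, s \in interp C V,
    (forall y, y \in e -> val y \in t) & forall y, y \in e -> (val y, f y) \in zip t s].

Lemma edge_view e : e \in Ha ->
  exists V t, t \in interp AV V /\ forall y, y \in e -> val y \in t.
Proof.
case/leV => g; rewrite inE => /mapP [t /tuplesP [V tV] ->] /subsetP eg.
by exists V, t; split=> // y /eg; rewrite inE.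
Qed.

Lemma eq_satisfied (f g : nat -> nat) (e : {set 'I_n}) :
  {in e, forall y : 'I_n, f y = g y} -> satisfied f e -> satisfied g e.
Proof.
move=> fg [V [t [s [tV sV et es]]]]; exists V, t, s; split=> // y ye.
by rewrite -fg // es.
Qed.

(* Hyperedges are added to a subtree of the join tree one by one; the part of the
   assignment already defined on a new one lies in its neighbour in the subtree. *)
Lemma satisfied_all (f : nat -> nat) (e0 : {set 'I_n}) : e0 \in Ha -> satisfied f e0 ->
  exists2 g : nat -> nat, {in e0, forall y : 'I_n, f y = g y} &
    forall e, e \in Ha -> satisfied g e.
Proof.
move=> e0H fe0; case: acyHa => E jt.
have : exists S, [/\ subtree Ha E S, e0 \in S & forall e, e \in S -> satisfied f e].
  exists [set e0]; split=> [||e /set1P ->] //; first exact: subtree1.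
  by rewrite set11.
case=> S [stS e0S fS]; have [k] := ubnP #|Ha :\: S|.
elim: k f S stS e0S fS {fe0} => // k IH f S stS e0S fS lek.
have [SH|SnH] := eqVneq S Ha; first by exists f => // e; rewrite -SH; exact: fS.
have Sn0 : S != set0 by apply/set0Pn; exists e0.
have [p [g [pS gHS stg run]]] := subtree_grow jt stS Sn0 SnH.
have [gnS gH] := setDP gHS.
have [V [t [s [tV sV pt ps]]]] := fS p pS.
have [W [u [uW gu]]] := edge_view gnS.
have [s' s'W es'] : exists2 s', s' \in interp C W &
    forall y b, y \in t -> y \in u -> ((y, b) \in zip u s') = ((y, b) \in zip t s).
  case: (boolP (has (fun y => y \in u) t)) => [tu|/hasPn ntu]; first exact: support tV uW sV tu.
  have [s' s'W] := C_nonempty sV uW; exists s' => // y b /ntu /negP nyu yu.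
  by case: nyu.
pose f' (y : nat) := if [exists z in g, val z == y] then lookup (zip u s') y else f y.
have f'g (y : 'I_n) : y \in g -> f' y = lookup (zip u s') y.
  by move=> yg; rewrite /f'; case: existsP => // -[]; exists y; rewrite yg /=.
have lk y : y \in u -> (y, lookup (zip u s') y) \in zip u s'.
  by apply: lookup_mem; exact: C_size uW s'W.
have f'S e : e \in S -> {in e, forall y : 'I_n, f y = f' y}.
  move=> eS y ye; rewrite /f'; case: existsP => // -[z /andP [zg /eqP /val_inj zy]].
  subst z; have yp := run e y eS ye zg.
  have h1 : (val y, f y) \in zip u s' by rewrite es' ?ps ?pt ?gu.
  exact: C_functional uW s'W h1 (lk _ (gu _ zg)).
have [|e /setU1P [->|eS]||h hf' hH] := IH f' (g |: S) stg.
- by apply/setU1P; right.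
- by exists W, u, s'; split=> // y yg; rewrite f'g // lk // gu.
- by apply: eq_satisfied (fS e eS); exact: f'S.
- rewrite -ltnS; apply: leq_trans lek; rewrite ltnS; apply: proper_card; apply/properP; split.
    by apply/subsetP => e; rewrite !inE negb_or => /andP [/andP [_ ->] ->].
  by exists g; rewrite // !inE eqxx.
exists h => // y ye0; rewrite -hf' //; exact: f'S ye0.
Qed.

Lemma satisfied_hom f : (forall x : 'I_n, exists2 e, e \in Ha & x \in e) ->
  (forall e, e \in Ha -> satisfied f e) ->
  Defs.hom A B f /\ forall x, x < n -> [:: f x] \in interp C (dom_view x).
Proof.
move=> cov fH.
have fdom x : x < n -> [:: f x] \in interp C (dom_view x).
  move=> xn; have [e eH xe] := cov (Ordinal xn).
  have [V [t [s [tV sV et es]]]] := fH e eH.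
  have [v vx ev] := to_dom tV sV (et _ xe).
  by have := es _ xe; rewrite ev => /eqP ->.
split=> //; split=> [x xn|R t tR]; first exact: C_dom_univ (fdom x xn).
have [_ /allP tn] : 0 < size t /\ all (fun x => x < univ A) t.
  by case: cAB => -[wA _] _ _; exact: wf_interp tR.
have [|e eH /subsetP te] := leA (e := [set i : 'I_n | (i : nat) \in t]).
  by rewrite inE; apply: map_f; apply/tuplesP; exists R.
have [V [u [s [uV sV eu es]]]] := fH e eH.
have te' y : y \in t -> exists2 z : 'I_n, z \in e & val z = y.
  by move=> yt; exists (Ordinal (tn y yt)) => //; apply: te; rewrite inE.
have tB : t \in interp AV (Base R t) by rewrite AV_base.
have [|s' s'R es'] := support uV tB sV.
  have : 0 < size t by case: (AV_tuple tB).
  case: (t) te' => // y r te' _; have [z ze <-] := te' y (mem_head _ _).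
  by apply/hasP; exists (val z); [exact: eu | exact: mem_head].
suff <- : s' = map f t by exact: C_base tR s'R.
apply: C_map tB s'R _ => y yt; have [z ze zy] := te' y yt.
by rewrite es' // -zy; [exact: es | exact: eu].
Qed.

End TreeProjection.
End Consistent.
End Views.

(** * Domain-restricted versions *)

Section Restriction.
Variables (A B : structure symbol) (D : seq (seq nat)).
Hypothesis cAB : csp A B.
Hypothesis chD : dom_choice A B D.

Let A' := restrict_left A.
Let B' := restrict_right A B D.

Lemma interp_cat (S : eqType) n (r1 r2 : seq ((S * nat) * seq (seq nat))) R :
  interp (Structure n (r1 ++ r2)) R = interp (Structure n r1) R ++ interp (Structure n r2) R.
Proof. by rewrite /interp filter_cat map_cat flatten_cat. Qed.

Lemma structure_eta (S : Type) (C : structure S) : Structure (univ C) (rels C) = C.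
Proof. by case: C. Qed.

Lemma undup_mem1 (T : eqType) (s : seq T) y :
  (forall t, (t \in s) = (t == y)) -> undup s = [:: y].
Proof.
move=> h; apply: perm_small_eq => //; apply: uniq_perm; rewrite ?undup_uniq // => t.
by rewrite mem_undup h inE.
Qed.

Lemma interp_fresh n vals R t : reflect
  (exists x, [/\ x < univ A, ~~ domain_restricted A x, R = Dom x & t \in vals x])
  (t \in interp (Structure n (fresh_doms A vals)) R).
Proof.
apply: (iffP (interpP _ _ _)) => [[r /mapP [x]]|[x [xA dx -> tx]]].
  by rewrite mem_filter mem_iota => /andP [dx xA] -> [<- tx]; exists x.
exists ((Dom x, 1), vals x) => //; apply/mapP; exists x => //.
by rewrite mem_filter mem_iota dx.
Qed.

Lemma fresh_symbol x : ~~ domain_restricted A x -> Dom x \notin symbols A.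
Proof. by case: cAB => -[_ h] _ _; apply: contra => /h. Qed.

Lemma interp_left R t : (t \in interp A' R) = (t \in interp A R) ||
  (if R is Dom x then [&& x < univ A, ~~ domain_restricted A x & t == [:: x]] else false).
Proof.
rewrite /A' /restrict_left interp_cat mem_cat structure_eta; congr (_ || _).
apply/interp_fresh/idP => [[x [xA dx -> tx]]|].
  by rewrite xA dx -mem_seq1.
by case: R => // x /and3P [xA dx /eqP ->]; exists x; rewrite mem_seq1.
Qed.

Lemma interp_right R : R \in symbols A -> interp B' R = interp B R.
Proof.
move=> RA; rewrite /B' /restrict_right interp_cat.
suff -> : interp (Structure (univ B)
    (fresh_doms A (fun x => [seq [:: a] | a <- nth [::] D x]))) R = [::].
  by rewrite cats0 structure_eta.
case E: (interp _ R) => [//|t s].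
have /interp_fresh [x [_ dx RE _]] : t \in interp (Structure (univ B)
    (fresh_doms A (fun x => [seq [:: a] | a <- nth [::] D x]))) R by rewrite E mem_head.
by case/negP: (fresh_symbol dx); rewrite -RE.
Qed.

Lemma interp_right_fresh x : ~~ domain_restricted A x -> x < univ A ->
  forall t, (t \in interp B' (Dom x)) = (t \in [seq [:: a] | a <- nth [::] D x]).
Proof.
move=> dx xA t; rewrite /B' /restrict_right interp_cat mem_cat.
have /negbTE -> : t \notin interp (Structure (univ B) (rels B)) (Dom x).
  apply: contra (fresh_symbol dx); rewrite (csp_vocab _ cAB) structure_eta.
  exact: interp_symbols.
apply/interp_fresh/idP => [[y [_ _ [->]]] //|tx]; by exists x.
Qed.

Lemma dom_values x : x < univ A -> ~~ domain_restricted A x ->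
  (forall a, a \in nth [::] D x -> a < univ B) /\
  forall h, Defs.hom A B h -> h x \in nth [::] D x.
Proof.
move=> xA dx; case: cAB => -[wA _] wB pv.
case: (chD xA dx) => [[R [t [j [tR jt tj Dx]]]]|[_ Dx]].
  split=> [a|h [_ hr]]; rewrite Dx.
    case/mapP => s sR ->.
    have [_ /allP sB] := wf_interp wB sR; apply: sB; apply: mem_nth.
    by rewrite -(vocab_arity wA wB pv tR sR).
  apply/mapP; exists (map h t); first exact: hr.
  by rewrite (nth_map 0) // tj.
by split=> [a|h [hu _]]; rewrite Dx mem_iota // add0n; exact: hu.
Qed.

Lemma hom_restriction h : Defs.hom A' B' h <-> Defs.hom A B h.
Proof.
split=> -[hu hr]; split=> // R t tR.
  by rewrite -(interp_right (interp_symbols tR)); apply: hr; rewrite interp_left tR.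
move: tR; rewrite interp_left => /orP [tR|].
  by rewrite interp_right ?(interp_symbols tR) // hr.
case: R => // x /and3P [xA dx /eqP ->]; rewrite interp_right_fresh //.
by apply: map_f; apply: (dom_values xA dx).2.
Qed.

Lemma interp_left_Dom x : x < univ A -> [:: x] \in interp A' (Dom x).
Proof.
move=> xA; rewrite interp_left xA eqxx andbT /=.
case: (boolP (domain_restricted A x)) => [|_]; last exact: orbT.
by case/andP => _ /eqP h; rewrite orbF -mem_undup h mem_head.
Qed.

Lemma symbols_left_Dom x : Dom x \in symbols A' -> domain_restricted A' x.
Proof.
case: (cAB) => -[wA dA] wB pv xA'; rewrite /domain_restricted xA' andTb.
apply/eqP/undup_mem1 => t; rewrite interp_left.
case: (boolP (domain_restricted A x)) => dx.
  by case/andP: dx => _ /eqP h; rewrite andbF orbF -mem_undup h mem_seq1.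
have -> : (t \in interp A (Dom x)) = false.
  by apply/negP => /interp_symbols; apply/negP; exact: fresh_symbol.
suff -> : x < univ A by [].
move: xA'; rewrite mem_symbols => /hasP [r]; rewrite mem_cat => /orP [rA|].
  move=> /eqP rx; case/negP: (fresh_symbol dx); rewrite mem_symbols.
  by apply/hasP; exists r => //; apply/eqP.
by case/mapP => y; rewrite mem_filter mem_iota => /andP [_ yA] -> /= /eqP [<-].
Qed.

Lemma csp_restriction : csp A' B'.
Proof.
case: cAB => -[wA dA] wB pv.
have vA : vocab A' = vocab A ++
    [seq (Dom x, 1) | x <- iota 0 (univ A) & ~~ domain_restricted A x].
  by rewrite /vocab map_cat -[in LHS]map_comp.
have vB : vocab B' = vocab B ++
    [seq (Dom x, 1) | x <- iota 0 (univ A) & ~~ domain_restricted A x].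
  by rewrite /vocab map_cat -[in LHS]map_comp.
have pv' : perm_eq (vocab A') (vocab B') by rewrite vA vB perm_cat2r.
have uA' : uniq (symbols A').
  rewrite /symbols vA map_cat cat_uniq -/(symbols A) -map_comp.
  case/andP: (wA) => -> _ /=; rewrite map_inj_uniq; last by move=> x y [].
  rewrite filter_uniq ?iota_uniq // andbT; apply/hasPn => R /mapP [x].
  by rewrite mem_filter => /andP [dx _] ->; exact: fresh_symbol.
split=> //.
- split; first (rewrite /wf uA' /= all_cat; apply/andP; split).
  + by case/andP: wA.
  + apply/allP => r /mapP [x]; rewrite mem_filter mem_iota => /andP [_ /= xA] -> /=.
    by rewrite xA.
  exact: symbols_left_Dom.
rewrite /wf; have -> : uniq (symbols B') by rewrite /symbols -(perm_uniq (perm_map fst pv')).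
rewrite /= all_cat; apply/andP; split; first by case/andP: wB.
apply/allP => r /mapP [x]; rewrite mem_filter mem_iota => /andP [dx xA] -> /=.
apply/allP => t /mapP [a aD ->] /=; rewrite andbT.
exact: (dom_values xA dx).1.
Qed.

End Restriction.

(** * Correctness of the executions *)

Lemma solutionsP out h : reflect (exists d, Some (h, d) \in out) (h \in solutions out).
Proof.
apply: (iffP mapP) => [[[h' d] hd ->]|[d hd]].
  by exists d; move: hd; rewrite mem_pmap => /mapP [o oo ->].
by exists (h, d) => //; rewrite mem_pmap; apply/mapP; exists (Some (h, d)).
Qed.

Lemma mem_zip_map (t : seq nat) (h : nat -> nat) p :
  (p \in zip t (map h t)) = (p.1 \in t) && (p.2 == h p.1).
Proof.
case: p => y b; elim: t => //= x t IH; rewrite !inE IH xpair_eqE.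
by case: (y =P x) => [->|] //=; case: (b == h x) => //=; rewrite andbF.
Qed.

Scheme cpropagate_mut := Minimality for cpropagate Sort Prop
with cploop_mut := Minimality for cploop Sort Prop
with cpbody_mut := Minimality for cpbody Sort Prop.

Section Correctness.
Variables (A B : structure symbol) (D : seq (seq nat)).
Hypothesis cAB : csp A B.
Hypothesis chD : dom_choice A B D.
Hypothesis conA : connected A.
Let A' := restrict_left A.
Let B' := restrict_right A B D.
Variables AV BV : structure view_symbol.
Hypothesis vAV : view_structure A' AV.
Hypothesis lBV : legal A' B' AV BV.
Variables (xs : seq nat) (m : nat).
Hypothesis pxs : perm_eq xs (iota 0 (univ A)).
Hypothesis mxs : m <= size xs.
Let n := univ A.
Let ys := drop m xs.

Let cAB' : csp A' B'. Proof. exact: csp_restriction. Qed.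
Let domA' x : x < univ A' -> [:: x] \in interp A' (Dom x).
Proof. by move=> xA; exact: (@interp_left_Dom A x xA). Qed.

Lemma mem_xs x : (x \in xs) = (x < n).
Proof. by rewrite (perm_mem pxs) mem_iota. Qed.

Lemma uniq_xs : uniq xs.
Proof. by rewrite (perm_uniq pxs) iota_uniq. Qed.

Lemma size_xs : size xs = n.
Proof. by rewrite (perm_size pxs) size_iota. Qed.

Lemma connected_restriction : connected A'.
Proof.
case/andP: conA => n0 /forallP h; apply/andP; split=> //.
apply/forallP => x; apply/forallP => y; have /forallP /(_ y) := h x.
apply: connect_sub => u v /existsP [e /andP [eA uv]]; apply: connect1.
apply/existsP; exists e; rewrite uv andbT; move: eA; rewrite !inE.
case/mapP => t /tuplesP [R tR] ->; apply: map_f; apply/tuplesP; exists R.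
by rewrite interp_left tR.
Qed.

Lemma AV_unique V t u : t \in interp AV V -> u \in interp AV V -> t = u.
Proof.
move=> tV uV; case: vAV => _ _ /(_ V (interp_symbols tV)) [w hw] _.
by move: tV uV; rewrite !hw !inE => /eqP -> /eqP ->.
Qed.

Definition has_tree_projection : Prop :=
  exists Ha, tree_projection (hypergraph_of n A) (hypergraph_of n AV) Ha.

Definition agrees (h : nat -> nat) (a : seq nat) : Prop := map h (take (size a) xs) = a.

Definition fixed_doms (a : seq nat) (C : structure view_symbol) : Prop :=
  forall i, i < size a ->
    {subset interp C (dom_view (nth 0 xs i)) <= [:: [:: nth 0 a i]]}.

Definition contains_homs (a : seq nat) (C : structure view_symbol) : Prop :=
  forall h, Defs.hom A B h -> agrees h a ->
    forall V t, t \in interp AV V -> map h t \in interp C V.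

Definition call_inv (a : seq nat) (C : structure view_symbol) : Prop :=
  [/\ substructure C BV, fixed_doms a C, contains_homs a C
    & has_tree_projection -> 0 < size a -> exists2 h, Defs.hom A B h & agrees h a].

Definition loop_inv (a : seq nat) (C : structure view_symbol) : Prop :=
  [/\ substructure C BV, consistent AV C, fixed_doms a C, contains_homs a C
    & 0 < size a -> ~~ is_empty C].

Lemma gac_contains_homs a C C' :
  gac AV C C' -> contains_homs a C -> contains_homs a C'.
Proof.
case=> _ _ largest homs h hh ha V t tV.
pose P V s := all (fun t => s == map h t) (interp AV V).
have hP W u : u \in interp AV W -> map h u \in interp (filter_rels P C) W.
  move=> uW; rewrite interp_filter_rels mem_filter (homs h) // andbT.
  by apply/allP => w wW; rewrite (AV_unique uW wW).
have [] := largest (filter_rels P C).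
- exact: filter_rels_sub.
- move=> V1 W t1 u1 tV1 uW X X0 s; rewrite interp_filter_rels mem_filter.
  case/andP => /allP /(_ _ tV1) /eqP -> _; exists (map h u1); first exact: hP.
  move=> p; rewrite /proj /X !mem_filter !mem_zip_map.
  by case: (p.1 \in u1); case: (p.1 \in t1).
- by move=> _ _; apply; exact: hP.
Qed.

Lemma call_loop_inv a C C' : gac AV C C' -> ~~ ((0 < size a) && is_empty C') ->
  call_inv a C -> loop_inv a C'.
Proof.
move=> g ne [sub fixa homs _]; have [sub' con' _] := g; split=> //.
- exact: substructure_trans sub' sub.
- by move=> i ia s; case: sub' => _ _ h /h; exact: fixa.
- exact: gac_contains_homs homs.
- by move=> a0; move: ne; rewrite a0.
Qed.

Lemma is_emptyPn (C : structure view_symbol) :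
  reflect (exists V s, s \in interp C V) (~~ is_empty C).
Proof.
apply: (iffP allPn) => [[r rC r0]|[V [s /interpP [r rC [_ sr]]]]].
  case E: r.2 r0 => [|s ss] // _; exists r.1.1, s; apply/interpP; exists r => //.
  by rewrite E mem_head.
by exists r => //; apply: contraTN sr; rewrite /nilp size_eq0 => /eqP ->.
Qed.

Lemma dom_nonempty C x : substructure C BV -> consistent AV C -> ~~ is_empty C ->
  x < n -> exists v, [:: v] \in interp C (dom_view x).
Proof.
move=> sub con /is_emptyPn [V [s sV]] xn.
have xV : [:: x] \in interp AV (dom_view x) by rewrite (AV_dom vAV domA').
have [s' s'x] := C_nonempty vAV lBV domA' sub con connected_restriction sV xV.
by have [v s'E] := C_dom vAV lBV domA' sub xn s'x; exists v; rewrite -s'E.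
Qed.

Lemma covered x : 1 < n -> x < n -> exists e : {set 'I_n}, e \in hypergraph_of n A /\
  exists2 y : 'I_n, val y = x & y \in e.
Proof.
move=> n1 xn; have [z zx] : exists z : 'I_n, z != Ordinal xn.
  have n0 : 0 < n by lia.
  case: (posnP x) => x0; first by exists (Ordinal n1); rewrite -val_eqE /= x0.
  by exists (Ordinal n0); rewrite -val_eqE /=; lia.
case/andP: conA => _ /forallP /(_ (Ordinal xn)) /forallP /(_ z) /connectP [[|w p] /=].
  by move=> _ zE; rewrite zE eqxx in zx.
case/andP => /existsP [e /andP [eH /andP [xe _]]] _ _.
by exists e; split=> //; exists (Ordinal xn).
Qed.

Lemma cons_drop (a : seq nat) x xs' : drop (size a) xs = x :: xs' ->
  [/\ size a < size xs, x = nth 0 xs (size a), x < n & xs' = drop (size a).+1 xs].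
Proof.
move=> dx; have lta : size a < size xs.
  by rewrite ltnNge; apply/negP => /drop_oversize; rewrite dx.
have [<- <-] : nth 0 xs (size a) :: drop (size a).+1 xs = x :: xs' by rewrite -drop_nth.
by rewrite -mem_xs mem_nth.
Qed.

Lemma extend_hom a C x xs' v : loop_inv a C -> drop (size a) xs = x :: xs' ->
  xs' != [::] -> [:: v] \in interp C (dom_view x) -> has_tree_projection ->
  exists2 h, Defs.hom A B h & agrees h (rcons a v).
Proof.
move=> [sub con fixa _ _] dx xs'0 vx [Ha [acy leA leV]].
have [lta xE xn _] := cons_drop dx.
have n1 : 1 < n.
  rewrite -size_xs; have : size (drop (size a) xs) = (size xs').+1 by rewrite dx.
  by rewrite size_drop; case: (xs') xs'0 => //= y r _; lia.
have cov (y : 'I_n) : exists2 e, e \in Ha & y \in e.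
  have [e [/leA [f fH /subsetP ef] [z zy ze]]] := covered n1 (ltn_ord y).
  by exists f => //; rewrite -(val_inj zy); exact: ef.
have leA' : hle (hypergraph_of n A') Ha.
  move=> e; rewrite inE => /mapP [t /tuplesP [R]]; rewrite interp_left => /orP [tR|tD] ->.
    by apply: leA; rewrite inE; apply: map_f; apply/tuplesP; exists R.
  case: R tD => // y /and3P [yn _ /eqP ->].
  have [f fH yf] := cov (Ordinal yn); exists f => //.
  apply/subsetP => z; rewrite inE mem_seq1 => /eqP zy.
  by rewrite (_ : z = Ordinal yn) //; exact: val_inj.
have [e0 e0H xe0] := cov (Ordinal xn).
have [V [t [tV e0t]]] := edge_view leV e0H.
have xt : x \in t by exact: e0t xe0.
have xV : [:: x] \in interp AV (dom_view x) by rewrite (AV_dom vAV domA').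
have [|s sV sx] := support con xV tV vx; first by rewrite /= xt.
have f0e : satisfied (A := A') AV C (lookup (zip t s)) e0.
  exists V, t, s; split=> // y /e0t yt; apply: lookup_mem => //.
  exact: C_size vAV lBV _ sub _ _ _ tV sV.
have [f fe0 fH] := satisfied_all vAV lBV domA' sub con connected_restriction acy leV e0H f0e.
have [fhom fdom] := satisfied_hom cAB' vAV lBV domA' sub con leA' cov fH.
exists f; first exact: (proj1 (hom_restriction cAB chD f)) fhom.
rewrite /agrees size_rcons (take_nth 0 lta) map_rcons -xE; congr rcons.
  have szt : size (take (size a) xs) = size a by rewrite size_take lta.
  apply: (@eq_from_nth _ 0); rewrite size_map szt // => i ia.
  rewrite (nth_map 0) ?szt // nth_take //.
  have : nth 0 xs i < n by rewrite -mem_xs mem_nth // (ltn_trans ia).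
  by move/fdom/(fixa i ia); rewrite mem_seq1 => /eqP [].
rewrite -[x]/(val (Ordinal xn)) -fe0 //=.
have h1 : (x, lookup (zip t s) x) \in zip t s.
  by apply: lookup_mem => //; exact: C_size vAV lBV _ sub _ _ _ tV sV.
by move: h1; rewrite sx ?mem_head //= mem_seq1 => /eqP [].
Qed.

Lemma leaf_hom a C x v : loop_inv a C -> drop (size a) xs = [:: x] ->
  [:: v] \in interp C (dom_view x) ->
  exists2 h, Defs.hom A B h & rcons a v = map h xs.
Proof.
move=> inv dx vx; have [sub con fixa _ _] := inv.
have [lta xE xn _] := cons_drop dx.
have sz : size xs = size (rcons a v).
  by have := congr1 size dx; rewrite size_drop size_rcons /=; lia.
pose f := lookup (zip xs (rcons a v)).
have fE : rcons a v = map f xs.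
  apply: (@eq_from_nth _ 0); rewrite ?size_map -?sz // => i ix.
  by rewrite (nth_map 0) // /f lookup_zip // index_uniq // uniq_xs.
have fdom y w : y < n -> [:: w] \in interp C (dom_view y) -> y != x -> w = f y.
  rewrite -mem_xs => /(nthP 0) [i ix <-] wy.
  have [ia|] := ltnP i (size a).
    move: (fixa i ia _ wy); rewrite mem_seq1 => /eqP [->] _.
    by rewrite -[RHS](nth_map 0 0) // -fE nth_rcons ia.
  rewrite leq_eqVlt => /predU1P [<-|]; first by rewrite xE eqxx.
  by move: ix; rewrite sz size_rcons; lia.
have fx : f x = v.
  by rewrite xE -[LHS](nth_map 0 0) // -fE nth_rcons ltnn eqxx.
have neC : ~~ is_empty C by apply/is_emptyPn; exists (dom_view x), [:: v].
exists f => //; split=> [y yn|R t tR].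
  have [->|yx] := eqVneq y x; first by rewrite fx; exact: C_dom_univ cAB' lBV domA' _ sub _ _ xn vx.
  have [w wy] := dom_nonempty sub con neC yn; rewrite -(fdom y w) //.
  exact: C_dom_univ cAB' lBV domA' _ sub _ _ yn wy.
have tR' : t \in interp A' R by rewrite interp_left tR.
have tB : t \in interp AV (Base R t) by rewrite (AV_base vAV).
have xV : [:: x] \in interp AV (dom_view x) by rewrite (AV_dom vAV domA').
have [s sR sx] : exists2 s, s \in interp C (Base R t) & x \in t -> (x, v) \in zip t s.
  case: (boolP (x \in t)) => xt.
    have [|s sR sx] := support con xV tB vx; first by rewrite /= xt.
    by exists s => // _; rewrite sx ?mem_head.
  have [s sR] := C_nonempty vAV lBV domA' sub con connected_restriction vx tB.
  by exists s.
have -> : map f t = s.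
  apply/esym; apply: (C_map vAV lBV domA' sub con tB sR) => y yt.
  have [yx|yx] := eqVneq y x; first by rewrite yx fx sx // -yx.
  have [w wy ew] := to_dom vAV lBV domA' sub con tB sR yt.
  have yn : y < n by have [_] := AV_tuple vAV tB; apply.
  by rewrite ew (fdom y w).
rewrite -(interp_right D cAB (interp_symbols tR)).
exact: C_base lBV _ sub _ _ _ tR' sR.
Qed.

Definition call_result (a : seq nat) (out : seq output) (b : bool) : Prop :=
  [/\ uniq (solutions out),
      forall h c, Some (h, c) \in out -> exists2 f, Defs.hom A B f &
        [/\ agrees f a, h = take m (map f xs) & c = zip ys (drop m (map f xs))],
      None \in out -> ~ has_tree_projection,
      b -> None \in out
    & None \notin out ->
      (forall h, Defs.hom A B h -> agrees h a -> size a <= m ->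
         map h (take m xs) \in solutions out) /\
      (m < size a -> take m a \in solutions out)].

Definition loop_result (a : seq nat) (x : nat) (vs : seq nat) (out : seq output)
    (b : bool) : Prop :=
  [/\ uniq (solutions out),
      forall h c, Some (h, c) \in out -> exists2 f, Defs.hom A B f &
        [/\ agrees f a, f x \in vs, h = take m (map f xs) & c = zip ys (drop m (map f xs))],
      None \in out -> ~ has_tree_projection,
      b -> None \in out
    & None \notin out ->
      (forall h, Defs.hom A B h -> agrees h a -> h x \in vs -> size a < m ->
         map h (take m xs) \in solutions out) /\
      (m <= size a -> vs != [::] -> take m a \in solutions out)].

Lemma solutions_cat out1 out2 : solutions (out1 ++ out2) = solutions out1 ++ solutions out2.
Proof. by rewrite /solutions pmap_cat map_cat. Qed.

Lemma agrees_rcons h (a : seq nat) v x xs' : drop (size a) xs = x :: xs' ->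
  agrees h (rcons a v) <-> agrees h a /\ h x = v.
Proof.
move=> dx; have [lta xE _ _] := cons_drop dx.
rewrite /agrees size_rcons (take_nth 0 lta) map_rcons -xE; split=> [/rcons_inj [] //|[-> ->]] //.
Qed.

Lemma execution_result zs C a out b : cpropagate AV m ys zs C a out b ->
  zs = drop (size a) xs -> call_inv a C -> call_result a out b.
Proof.
apply: (cpropagate_mut
  (P := fun zs C a out b => zs = drop (size a) xs -> call_inv a C -> call_result a out b)
  (P0 := fun x xs' C a vs out b => x :: xs' = drop (size a) xs -> loop_inv a C -> uniq vs ->
     {in vs, forall v, [:: v] \in interp C (dom_view x)} -> loop_result a x vs out b)
  (P1 := fun x xs' C a v out b => x :: xs' = drop (size a) xs -> loop_inv a C ->
     [:: v] \in interp C (dom_view x) -> call_result (rcons a v) out b)).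
- move=> x xs' C0 C1 a0 g a0n emp /esym dx inv; have [lta xE xn _] := cons_drop dx.
  split=> // _ tp.
  have [_ _ homs /(_ tp a0n) [h hh ha]] := inv.
  have hx := gac_contains_homs g homs hh ha (V := dom_view x) (t := [:: x]).
  have xV : [:: x] \in interp AV (dom_view x) by rewrite (AV_dom vAV domA').
  have /is_emptyPn : exists V s, s \in interp C1 V.
    by exists (dom_view x), (map h [:: x]); exact: hx xV.
  by rewrite emp.
- move=> x xs' C0 C1 a0 vs out0 b0 g ne uvs vsE _ IH /esym dx inv.
  have [lta xE xn _] := cons_drop dx; have linv := call_loop_inv g ne inv.
  have vsP v : (v \in vs) = ([:: v] \in interp C1 (dom_view x)).
    by rewrite -vsE mem_map // => y z [].
  have [|r1 r2 r3 r4 r5] := IH (esym dx) linv uvs; first by move=> v; rewrite vsP.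
  split=> // [h c /r2 [f fh [fa _ -> ->]]|/r5 [r6 r7]]; first by exists f.
  have homvs h : Defs.hom A B h -> agrees h a0 -> h x \in vs.
    move=> hh ha; rewrite vsP; case: linv => _ _ _ homs _.
    by apply: (homs h hh ha (dom_view x) [:: x]); rewrite (AV_dom vAV domA').
  split=> [h hh ha|lt].
    rewrite leq_eqVlt => /predU1P [am|]; last by apply: r6 => //; exact: homvs.
    rewrite -am ha -{1}(take_size a0) am; apply: r7; first by rewrite am.
    by apply: contraTneq (homvs h hh ha) => ->.
  apply: r7; first exact: ltnW.
  case: (linv) => sub con _ _ /(_ (leq_ltn_trans (leq0n _) lt)) neC.
  have [v] := dom_nonempty sub con neC xn; rewrite -vsP.
  by apply: contraTneq => ->.
- move=> x xs' C0 a0 _ _ _ _; split=> // _; split=> // h _ _; by rewrite in_nil.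
- move=> x xs' C0 a0 v vs out0 _ IH dx inv uvs vsP.
  have [r1 r2 r3 r4 r5] := IH dx inv (vsP v (mem_head _ _)).
  split=> // [h c /r2 [f fh [/(agrees_rcons _ _ (esym dx)) [fa fx] -> ->]]|].
    by exists f => //; split=> //; rewrite fx mem_head.
  by rewrite r4.
- move=> x xs' C0 a0 v vs out0 _ IH lt dx inv uvs vsP.
  have [r1 r2 r3 r4 r5] := IH dx inv (vsP v (mem_head _ _)).
  split=> // [h c /r2 [f fh [/(agrees_rcons _ _ (esym dx)) [fa fx] -> ->]]|/r5 [_ r6]].
    by exists f => //; split=> //; rewrite fx mem_head.
  split=> [h _ _ _ lt'|le _]; first by move: (leq_trans lt' lt); rewrite ltnn.
  by move: r6; rewrite size_rcons -cats1 takel_cat //; apply.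
- move=> x xs' C0 a0 v vs out1 out2 b0 _ IH1 le _ IH2 dx inv /= /andP [vvs uvs] vsP.
  have [r1 r2 r3 r4 r5] := IH1 dx inv (vsP v (mem_head _ _)).
  have [|q1 q2 q3 q4 q5] := IH2 dx inv uvs; first by move=> w wvs; apply: vsP; rewrite inE wvs orbT.
  have xs_x f : size a0 < m -> nth 0 (take m (map f xs)) (size a0) = f x.
    move=> lt; have [lta xE _ _] := cons_drop (esym dx).
    by rewrite nth_take // (nth_map 0) // xE.
  split.
  + rewrite solutions_cat cat_uniq r1 q1 andbT; apply/hasPn => h /solutionsP [c hc].
    apply/negP => /solutionsP [c' hc'].
    have [f fh [fa fx hE _]] := q2 _ _ hc; have [f' fh' [fa' hE' _]] := r2 _ _ hc'.
    have [_ fx'] := (agrees_rcons f' v (esym dx)).1 fa'.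
    move: vvs; rewrite -fx' -xs_x // -hE' hE xs_x // fx.
    by [].
  + move=> h c; rewrite mem_cat => /orP [/r2|/q2] [f fh].
      case=> /(agrees_rcons _ _ (esym dx)) [fa fx] -> ->; exists f => //; split=> //.
      by rewrite fx mem_head.
    by case=> fa fx -> ->; exists f => //; split=> //; rewrite inE fx orbT.
  + by rewrite mem_cat => /orP [/r3|/q3].
  + by move=> /q4 h; rewrite mem_cat h orbT.
  rewrite mem_cat negb_or => /andP [/r5 [r6 _] /q5 [q6 _]].
  split=> [h hh ha|ma]; last by move: (leq_trans le ma); rewrite ltnn.
  rewrite inE solutions_cat mem_cat => /predU1P [hx|hx] lt.
    by rewrite r6 ?size_rcons //; apply/(agrees_rcons _ _ (esym dx)).
  by rewrite q6 ?orbT.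
- move=> x C0 a0 v dx inv vx; have [f fh fE] := leaf_hom inv (esym dx) vx.
  have sa : size (rcons a0 v) = size xs by rewrite fE size_map.
  split=> //.
  + move=> h c; rewrite mem_seq1 => /eqP [-> ->]; exists f => //; rewrite -fE; split=> //.
    by rewrite /agrees sa take_size.
  move=> _; have sE : solutions [:: Some (take m (rcons a0 v), zip ys (drop m (rcons a0 v)))] =
    [:: take m (rcons a0 v)] by [].
  rewrite sE; split=> [h hh|_]; last by rewrite mem_seq1.
  by rewrite /agrees sa take_size => <- _; rewrite mem_seq1 map_take.
- move=> x y xs' C0 a0 v out0 b0 _ IH dx inv vx.
  have [lta xE xn xsE] := cons_drop (esym dx).
  apply: IH; first by rewrite size_rcons xsE.
  have [sub con fixa homs ne] := inv; have xC := interp_symbols vx.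
  split.
  + case: sub => u1 v1 s1; split; [exact: u1| by rewrite vocab_set_rel|].
    move=> V t; rewrite interp_set_rel xC; case: eqP => [->|_]; last exact: s1.
    by rewrite mem_seq1 => /eqP ->; exact: s1.
  + move=> i; rewrite size_rcons ltnS => ia s; rewrite interp_set_rel xC.
    move: ia; rewrite leq_eqVlt nth_rcons => /predU1P [ia|ia].
      by rewrite ia -xE eqxx ltnn eqxx.
    rewrite ia; case: eqP => [/dom_view_inj e|_]; last exact: fixa.
    have := nth_uniq 0 (ltn_trans ia lta) lta uniq_xs; rewrite -xE e eqxx.
    by move/esym/eqP => e'; rewrite e' ltnn in ia.
  + move=> h hh /(agrees_rcons _ _ (esym dx)) [ha hx] V t tV.
    rewrite interp_set_rel xC; case: eqP => [e|_]; last exact: homs.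
    by move: tV; rewrite e (AV_dom vAV domA') // => /eqP ->; rewrite /= hx mem_head.
  by move=> tp _; apply: extend_hom inv (esym dx) _ vx tp.
Qed.

End Correctness.

(** * Running time *)

Lemma undup_eq1 (T : eqType) (s : seq T) y :
  (undup s == [:: y]) = ~~ nilp s && all (fun t => t == y) s.
Proof.
apply/eqP/andP => [h|[s0 /allP h]].
  split; first by apply: contraTN (mem_head y [::]) => /nilP s0; rewrite -h s0.
  by apply/allP => t; rewrite -mem_undup h mem_seq1.
apply: undup_mem1 => t; apply/idP/idP => [/h //|/eqP ->].
by case: (s) s0 h => // x r _ h; rewrite -(eqP (h x _)) ?mem_head.
Qed.

Lemma ptime_domain_restricted E `{encoding E} (A : E -> structure symbol) x :
  ptime A -> ptime x -> ptime (fun e => domain_restricted (A e) (x e)).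
Proof.
move=> hA hx; apply: ptime_on2 hA hx.
apply: (@ptime_ext _ _ _ _ _ (fun p => (Dom p.2 \in symbols p.1) &&
  (~~ nilp (interp p.1 (Dom p.2)) && all (fun t => t == [:: p.2]) (interp p.1 (Dom p.2))))).
  by move=> p; rewrite /domain_restricted undup_eq1.
by rewrite /symbols /vocab; ptime_auto.
Qed.

Lemma ptime_restrict_left : ptime restrict_left.
Proof.
rewrite /restrict_left /fresh_doms; ptime_auto.
by apply: ptime_domain_restricted; ptime_auto.
Qed.

Lemma ptime_restrict_right :
  ptime (fun p : structure symbol * (structure symbol * seq (seq nat)) =>
    restrict_right p.1 p.2.1 p.2.2).
Proof.
rewrite /restrict_right /fresh_doms; ptime_auto.
by apply: ptime_domain_restricted; ptime_auto.
Qed.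

Definition initial_context (M : dm) (I : instance) (c : choice) : context :=
  let A' := restrict_left (lhs I) in
  ((l_dm M A', r_dm M A' (restrict_right (lhs I) (rhs I) c.2)),
   (outv I ++ c.1, size (outv I))).

Lemma ptime_initial_context M rho : decomposition_method M -> choice_policy rho ->
  ptimeD ecsp (fun I => initial_context M I (rho I)).
Proof.
case=> hl hr hlr [vrho hrho].
have {}hl : ptimeD wf_left (l_dm M) by apply: (proj2 (polytime_ptime _ _)).
have {}hr : ptimeD (fun AB : structure symbol * structure symbol => csp AB.1 AB.2)
    (fun AB => r_dm M AB.1 AB.2) by apply: (proj2 (polytime_ptime _ _)).
have {}hrho : ptimeD ecsp (rho : instance -> seq nat * seq (seq nat)).
  by apply: (proj2 (polytime_ptime _ _)).
have [h1 h2 h3] := ptime_instance (ptime_id ecsp).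
have hA : ptimeD ecsp (fun I => restrict_left (lhs I)).
  exact: ptime_comp h1 ptime_restrict_left _.
have hB : ptimeD ecsp (fun I => restrict_right (lhs I) (rhs I) (rho I).2).
  have hp := ptime_pair h1 (ptime_pair h2 (ptime_snd hrho)).
  exact: ptime_comp hp ptime_restrict_right _.
have cI I : ecsp I ->
    csp (restrict_left (lhs I)) (restrict_right (lhs I) (rhs I) (rho I).2).
  by move=> eI; have [cI _ _] := eI; apply: csp_restriction => //; case: (vrho I eI).
apply: ptime_pair.
  apply: ptime_pair; first by apply: ptime_comp hA hl _ => I /cI [].
  exact: ptime_comp (ptime_pair hA hB) hr cI.
apply: ptime_pair; first exact: ptime_cat h3 (ptime_fst hrho).
have hs : ptime (fun s : seq nat => size s) by ptime_auto.
exact: ptime_comp h3 hs _.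
Qed.

Lemma delay_le_shift d c c' k l :
  delay_le d c l -> c' <= c + k -> delay_le (d + k) c' l.
Proof.
elim: l c c' => [|[x|] l IH] c c' /=.
- by move=> cd ck; apply: leq_trans ck _; rewrite leq_add2r.
- case/andP => cd dl ck; rewrite (leq_trans ck) ?leq_add2r //.
  exact: IH dl _.
- by move=> dl ck; apply: IH dl _; rewrite addSn ltnS.
Qed.

Lemma filter_rels_true (S : eqType) (C : structure S) :
  filter_rels (fun _ _ => true) C = C.
Proof.
rewrite -[RHS]structure_eta /filter_rels; congr Structure; rewrite -[RHS]map_id.
by apply: eq_map => -[x y] /=; rewrite filter_predT.
Qed.

Section RunOnInstance.
Variables (M : dm) (hM : decomposition_method M) (I : instance) (c : choice).
Hypothesis eI : ecsp I.
Hypothesis conI : connected (lhs I).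
Hypothesis vc : valid_choice I c.

Let AV := l_dm M (restrict_left (lhs I)).
Let BV := r_dm M (restrict_left (lhs I)) (restrict_right (lhs I) (rhs I) c.2).
Let xs := outv I ++ c.1.
Let m := size (outv I).

Let cI : csp (lhs I) (rhs I). Proof. by case: eI. Qed.
Let dc : dom_choice (lhs I) (rhs I) c.2. Proof. by case: vc. Qed.
Let pxs : perm_eq xs (iota 0 (univ (lhs I))). Proof. by case: vc. Qed.

Let views : view_structure (restrict_left (lhs I)) AV /\
  legal (restrict_left (lhs I)) (restrict_right (lhs I) (rhs I) c.2) AV BV.
Proof. by case: hM => _ _; apply; apply: csp_restriction. Qed.

Let vAV := proj1 views.
Let lBV := proj2 views.

Lemma drop_xs : drop m xs = c.1.
Proof. by rewrite /xs drop_size_cat. Qed.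

Lemma dom_BV x t : x \in xs -> t \in interp BV (dom_view x) -> size t = 1.
Proof.
rewrite (mem_xs pxs) => xA tx.
have [v ->] := C_dom vAV lBV (@interp_left_Dom (lhs I)) (substructure_refl BV) xA tx.
by [].
Qed.

Lemma active_nonempty a : 0 < size a < size xs -> ~~ fails AV BV xs a ->
  active AV BV xs m a != [::].
Proof.
case/andP => a0 lta; rewrite /fails a0 /= => ne.
have [sub con _] := gac_closureP AV (restrict_doms xs a BV).
have sub' := substructure_trans sub (filter_rels_sub _ BV).
have xn : nth 0 xs (size a) < univ (lhs I) by rewrite -(mem_xs pxs) mem_nth.
have [v vx] := dom_nonempty conI vAV lBV sub' con ne xn.
have [wBV _ _ _] := lBV.
have : [:: v] \in [seq [:: v] | v <- values AV BV xs a].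
  by rewrite (values_interp AV wBV dom_BV lta).
case/mapP => w wv _; rewrite /active.
by case: (values AV BV xs a) wv => // y r _; case: ifP.
Qed.

Lemma execution_search : execution M I c (search AV BV xs m (size xs) [::]).1.
Proof.
have [wBV _ _ _] := lBV.
have xs0 : 0 < size xs by rewrite (size_xs pxs); case/andP: conI.
exists (search AV BV xs m (size xs) [::]).2.
have rE : restrict_doms xs [::] BV = BV.
  rewrite -[RHS]filter_rels_true /restrict_doms; congr filter_rels.
  by case: (xs).
have ga : gac AV BV (propagate AV BV xs [::]).
  by rewrite /propagate rE; exact: gac_closureP.
have := search_cpropagate (k := (size xs).-1) m (uniq_xs pxs) wBV dom_BV (a := [::]) _ ga.
by rewrite prednK // drop_xs drop0; apply.
Qed.

Lemma run_instance N bN : polynomial bN ->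
  (forall e : context * stack, exists2 k,
     eval N (enc e) (enc (machine_step e)) (tick k) & k <= bN (tsize e)) ->
  exists2 l, run N AV BV xs m [:: [::]] l &
    pmap id l = map enc_output (search AV BV xs m (size xs) [::]).1 /\
    delay_le ((2 * (tsize (initial_context M I c) + stack_bound BV xs).+1 +
               12 * bN (tsize (initial_context M I c) + stack_bound BV xs).+1) *
              (size xs).+3) 0 l.
Proof.
move=> pbN hN; have xs0 : 0 < size xs by rewrite (size_xs pxs); case/andP: conI.
have [l [h1 h2 h3]] := run_root pbN hN active_nonempty xs0.
by exists l => //; split=> //; exact: h3.
Qed.

End RunOnInstance.

Lemma tsize_context (AV BV : structure view_symbol) (xs : seq nat) (m : nat) :
  tsize xs <= tsize ((AV, BV), (xs, m)) /\ tsize (univ BV) <= tsize ((AV, BV), (xs, m)).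
Proof. by split; rewrite /=; lia. Qed.

Lemma delay_bound (M : dm) (hM : decomposition_method M) rho : choice_policy rho ->
  exists (P : prog) (p : {poly nat}),
    forall I : instance, ecsp I -> connected (lhs I) ->
      exists2 out : seq output, execution M I (rho I) out
        & runs_with_delay P (enc_instance I) (map enc_output out)
            (p.[tree_size (enc_instance I)])%R.
Proof.
move=> hrho; have [vrho _] := hrho.
have hinit := ptime_pair (ptime_initial_context hM hrho) (ptime_const ecsp ([:: [::]] : stack)).
have [P0 [b0 [pb0 hP0]]] := hinit.
have [N [bN [pbN hN]]] := ptime_machine_step.
pose s z := (z.+1 * z.+1 * (z * (z + z).+2).+2).+1.
pose d z := (2 * (z + s z).+1 + 12 * bN (z + s z).+1) * z.+3.
have ps : polynomial s by rewrite /s; poly.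
have pd : polynomial d by rewrite /d; poly.
have [p hp] : polynomial (fun z => d (b0 z) + b0 z) by poly.
exists (PComp P0 (loop N)), p => I eI conI.
exists (search (l_dm M (restrict_left (lhs I)))
  (r_dm M (restrict_left (lhs I)) (restrict_right (lhs I) (rhs I) (rho I).2))
  (outv I ++ (rho I).1) (size (outv I)) (size (outv I ++ (rho I).1)) [::]).1.
  exact: execution_search (vrho I eI).
have [k0 ek0 lk0] := hP0 I eI.
have hN' : forall e : context * stack, exists2 k,
    eval N (enc e) (enc (machine_step e)) (tick k) & k <= bN (tsize e).
  by move=> e; exact: hN.
have [l rl [pl dl]] := run_instance hM eI conI (vrho I eI) pbN hN'.
eexists; exists (tick k0 ++ l); split.
- exact: ev_comp ek0 rl.
- by rewrite pmap_tick pl.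
move=> l1 k l2 lE; rewrite -hp.
have := delay_le_shift (k := k0) dl (leqnn k0).
rewrite -[X in delay_le _ X _](add0n k0) -delay_le_tick lE => /delay_le_infix kd.
apply: leq_trans kd _; apply: (leq_add _ lk0).
set ctx := initial_context _ _ _; set BV := r_dm _ _ _; set xs := _ ++ _.
have cz : tsize ctx <= b0 (tsize I).
  apply: leq_trans lk0; have [_] := eval_size ek0; rewrite size_tick.
  by apply: leq_trans; rewrite /= leqW // leq_addr.
have xz : size xs <= tsize ctx.
  have : tsize xs <= tsize ctx by exact: (tsize_context _ _ _ _).1.
  by apply: leq_trans; exact: ltnW (size_le_tsize _).
have uz : univ BV <= tsize ctx.
  have : tsize (univ BV) <= tsize ctx by exact: (tsize_context _ _ _ _).2.
  by rewrite tsize_nat; lia.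
have sz : stack_bound BV xs <= s (tsize ctx).
  rewrite /stack_bound /s ltnS; apply: leq_mul; first by apply: leq_mul.
  rewrite !ltnS; apply: leq_mul => //; rewrite !ltnS -addnn; exact: leq_add.
apply: leq_trans (_ : d (tsize ctx) <= _); last exact: polynomial_mono.
rewrite /d; apply: leq_mul; last by rewrite !ltnS.
apply: leq_add; first by rewrite leq_mul2l ltnS leq_add2l.
by rewrite leq_mul2l; apply: polynomial_mono; rewrite // ltnS leq_add2l.
Qed.

(** * Certificates *)

Lemma certified_size (I : instance) ys (f : nat -> nat) (a : seq nat) m N :
  perm_eq (outv I ++ ys) (iota 0 (univ (lhs I))) -> Defs.hom (lhs I) (rhs I) f ->
  a = map f (outv I ++ ys) -> m = size (outv I) -> N = tsize I ->
  tsize (I, (take m a, zip ys (drop m a))) <=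
    N + (N * (N + N).+2 + N * (N + N + (N + N)).+4).+4.
Proof.
move=> pI [hu _] aI mI NI.
have [uA uB] : univ (lhs I) <= N /\ univ (rhs I) <= N.
  have := tsize_nat (univ (lhs I)); have := tsize_nat (univ (rhs I)).
  by rewrite NI /enc /=; lia.
have sI : size (outv I ++ ys) = univ (lhs I) by rewrite (perm_size pI) size_iota.
have ltI x : x \in outv I ++ ys -> x < univ (lhs I) by rewrite (perm_mem pI) mem_iota.
have aE : take m a = map f (outv I) by rewrite aI mI map_cat take_size_cat ?size_map.
have dE : drop m a = map f ys by rewrite aI mI map_cat drop_size_cat ?size_map.
have h1 : tsize (take m a) <= (N * (N + N).+2).+1.
  apply: leq_trans (tsize_all (p := fun v => v < univ (rhs I)) (b := (N + N).+1) _ _) _.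
  - by move=> v; rewrite tsize_nat; lia.
  - rewrite aE all_map; apply/allP => x xO; apply: hu; apply: ltI.
    by rewrite mem_cat xO.
  rewrite ltnS; apply: leq_mul => //; rewrite aE size_map.
  by move: sI; rewrite size_cat; lia.
have h2 : tsize (zip ys (drop m a)) <= (N * (N + N + (N + N)).+4).+1.
  apply: leq_trans (tsize_all (p := fun q => (q.1 < univ (lhs I)) && (q.2 < univ (rhs I)))
    (b := (N + N + (N + N)).+3) _ _) _.
  - move=> [x v] /andP [xA vB]; rewrite tsize_pair !tsize_nat.
    by move: xA vB => /=; lia.
  - rewrite dE; apply/allP => -[x v]; rewrite mem_zip_map /= => /andP [xy /eqP ->].
    have xA : x < univ (lhs I) by apply: ltI; rewrite mem_cat xy orbT.
    by rewrite xA hu.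
  rewrite ltnS; apply: leq_mul => //; rewrite dE size_zip size_map minnn.
  by move: sI; rewrite size_cat; lia.
by rewrite !tsize_pair -NI; lia.
Qed.

Theorem theorem7 (M : dm) (hM : decomposition_method M) :
  (exists rho, choice_policy rho) /\
  exists (V : prog), sound_checker V /\
  exists (q : {poly nat}),
  (* running time, however the free choices of the algorithm are made *)
  (forall rho : instance -> choice, choice_policy rho ->
    exists (P : prog) (p : {poly nat}),
    forall I : instance, ecsp I -> connected (lhs I) ->
      exists2 out : seq output, execution M I (rho I) out
        & runs_with_delay P (enc_instance I) (map enc_output out)
            (p.[tree_size (enc_instance I)])%R) /\
  (* correctness of every execution *)
  (forall (I : instance) (c : choice) (out : seq output),
    ecsp I -> connected (lhs I) -> valid_choice I c -> execution M I c out ->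
    let n := univ (lhs I) in
    [/\ uniq (solutions out),
        (forall h d, Some (h, d) \in out ->
           hom_restr (lhs I) (rhs I) (outv I) h /\
           accepts_within V I h d (q.[tree_size (enc_instance I)])%R),
        (None \in out ->
           ~ exists Ha, tree_projection (hypergraph_of n (lhs I))
               (hypergraph_of n (l_dm M (restrict_left (lhs I)))) Ha)
      & (None \notin out ->
           forall h, hom_restr (lhs I) (rhs I) (outv I) h ->
             h \in solutions out)]).
Proof.
split; first by exists default_choice; exact: choice_policy_default.
have [V [b [pb hV]]] := ptime_certifies.
exists V; split.
  move=> I h c u v l eI ev; apply: (certifies_sound (c := c)).
  have [k ek _] := hV (I, (h, c)) Logic.I.
  have [E _] := eval_inj ek ev.
  by move: E => /=; case: (certifies I h c).
have [q hq] : polynomial (fun N => b (N + (N * (N + N).+2 + N * (N + N + (N + N)).+4).+4)).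
  by poly.
exists q; split; first by move=> rho; exact: delay_bound.
move=> I c out eI conI vc [halted ex] n.
have [cI uO hO] := eI; have [pI dc] := vc.
have cI' := csp_restriction cI dc.
have [_ _ /(_ _ _ cI') [vAV lBV]] := hM.
set BV := r_dm M _ _ in lBV ex.
pose xs := outv I ++ c.1; pose m := size (outv I).
have dE : drop m xs = c.1 by rewrite /xs drop_size_cat.
have tE : take m xs = outv I by rewrite /xs take_size_cat.
have inv : call_inv (lhs I) (rhs I) (l_dm M (restrict_left (lhs I))) BV xs [::] BV.
  split=> //; first exact: substructure_refl.
  move=> h hh _ W t tW; have [_ _ lg _] := lBV; apply: lg tW _.
  by exists h => //; apply: (proj2 (hom_restriction cI dc h)).
have {}ex : cpropagate (l_dm M (restrict_left (lhs I))) m (drop m xs) xs BV [::] out halted.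
  by rewrite dE.
have mxs : m <= size xs by rewrite size_cat leq_addr.
have [r1 r2 r3 _ r5] := execution_result cI dc conI vAV lBV pI mxs ex (esym (drop0 _)) inv.
split=> //.
- move=> h d /r2 [f fh [_ hE dE']].
  have hE' : h = take m (map f xs) by exact: hE.
  split; first by exists f => //; rewrite hE' -map_take tE.
  have cert : certifies I h d.
    rewrite hE' dE' dE; apply: certifies_complete pI _ erefl fh.
    by case: cI => -[].
  have [k ek lk] := hV (I, (h, d)) Logic.I.
  rewrite /= cert in ek; exists Leaf, Leaf, k; split; first exact: ek.
  apply: leq_trans lk _; rewrite -hq; apply: polynomial_mono => //.
  by rewrite hE' dE' dE; exact: certified_size pI fh erefl erefl erefl.
move=> /r5 [r6 _] h [f fh ->]; rewrite -tE; apply: r6 => //.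
by rewrite /agrees take0.
Qed.
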